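(* Let $E$ be an Arens regular Banach lattice with separable dual $E^*$, and let $F$ be a Banach lattice such that the lattice operations in $F^{**}$ are weak*-sequentially continuous. Then, for every disjointness preserving regular bilinear operator $A\colon E\times E\to F$, the unique Arens extension of $A$ (the common operator $AR_2^{\rm id}(A)=AR_2^\theta(A)$) is disjointness preserving on $E^{**}\times E^{**}$.
   Context: Banach lattices are real; $E^*$, $E^{**}$ denote topological dual and bidual. A Banach space $E$ is Arens regular if every bounded linear operator from $E$ to $E^*$ is weakly compact. The lattice operations in $F^{**}$ are weak*-sequentially continuous if $|y_n^{**}|\to|y^{**}|$ in the weak* topology whenever $y_n^{**}\to y^{**}$ in the weak* topology of $F^{**}$ (equivalently, $\vee$ and $\wedge$ preserve weak*-convergence of sequences). A bilinear operator between Riesz spaces is positive if it takes positive values at pairs of positive vectors, and regular if it is a difference of two positive bilinear operators (it is then order bounded). Vectors $x,y$ are disjoint if $|x|\wedge|y|=0$. An order bounded bilinear operator is disjointness preserving if, upon fixing any vector in one of the variables, the resulting linear operator in the other variable sends disjoint vectors to disjoint vectors. For a regular bilinear operator $A\colon E_1\times E_2\to F$ between Banach lattices, its two Arens extensions $E_1^{**}\times E_2^{**}\to F^{**}$ are $$AR_2^\theta(A)(x_1^{**},x_2^{**})(y^* )=x_1^{**}\big(x_1\mapsto x_2^{**}(y^*\circ A(x_1,\cdot))\big),$$ $$AR_2^{\rm id}(A)(x_1^{**},x_2^{**})(y^* )=x_2^{**}\big(x_2\mapsto x_1^{**}(y^*\circ A(\cdot,x_2))\big),$$ for $y^*\in F^*$.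 (It is a known fact that if $E$ is Arens regular, the two Arens extensions of every continuous bilinear operator on $E\times E$ coincide; this is the meaning of ''unique Arens extension''.) *)

(* Defs.v *)
From HB Require Import structures.
From mathcomp Require Import all_boot all_order all_algebra.
From mathcomp Require Import all_classical reals topology normedtype sequences.
From mathcomp Require Import ring.
Set Implicit Arguments.
Unset Strict Implicit.
Unset Printing Implicit Defensive.
Import Order.TTheory GRing.Theory Num.Theory.
Import numFieldNormedType.Exports.
Local Open Scope classical_set_scope.
Local Open Scope ring_scope.

(* The order is carried by the mixin instead of being inherited from
   Order.Lattice: Num.NumDomain and Num.RealDomain already inherit from both
   Order.* and the additive and normed structures, so HB refuses a new join of
   these hierarchies. *)
HB.mixin Record Lmodule_isRiesz (R : realType) E of GRing.Lmodule R E := {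
  rle : rel E ;
  rle_refl : reflexive rle ;
  rle_anti : antisymmetric rle ;
  rle_trans : transitive rle ;
  rleD2r : forall z x y : E, rle x y -> rle (x + z) (y + z) ;
  rscale_ge0 : forall (a : R) (x : E), 0 <= a -> rle 0 x -> rle 0 (a *: x) ;
  rjoin : E -> E -> E ;
  rmeet : E -> E -> E ;
  rjoin_le : forall x y z : E, rle (rjoin x y) z = rle x z && rle y z ;
  rle_meet : forall x y z : E, rle z (rmeet x y) = rle z x && rle z y
}.

#[short(type="rieszSpaceType")]
HB.structure Definition RieszSpace (R : realType) :=
  {E of GRing.Lmodule R E & Lmodule_isRiesz R E}.

Arguments rleD2r {R s} z [x y] _.
Arguments rscale_ge0 {R s} [a x] _ _.

Reserved Notation "x ≼ y" (at level 70, no associativity).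
Notation "x ≼ y" := (rle x y) : ring_scope.

Definition rabs (R : realType) (E : rieszSpaceType R) (x : E) : E :=
  rjoin x (- x).

Definition disjoint_vectors (R : realType) (E : rieszSpaceType R) (x y : E) :=
  rmeet (rabs x) (rabs y) = 0.

HB.mixin Record CompleteNormed_Riesz_isBanachLattice (R : realType) E
    of CompleteNormedModule R E & RieszSpace R E := {
  ler_norm_rabs : forall x y : E, rabs x ≼ rabs y -> `|x| <= `|y|
}.

#[short(type="banachLatticeType")]
HB.structure Definition BanachLattice (R : realType) :=
  {E of CompleteNormedModule R E & RieszSpace R E
      & CompleteNormed_Riesz_isBanachLattice R E}.

Section riesz_theory.
Context {R : realType} {E : rieszSpaceType R}.
Implicit Types x y z : E.

Definition rpos x := rjoin x 0.

Lemma rle_joinl x y : x ≼ rjoin x y.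
Proof. by have := rjoin_le x y (rjoin x y); rewrite rle_refl => /esym/andP[]. Qed.

Lemma rle_joinr x y : y ≼ rjoin x y.
Proof. by have := rjoin_le x y (rjoin x y); rewrite rle_refl => /esym/andP[]. Qed.

Lemma rmeet_lel x y : rmeet x y ≼ x.
Proof. by have := rle_meet x y (rmeet x y); rewrite rle_refl => /esym/andP[]. Qed.

Lemma rmeet_ler x y : rmeet x y ≼ y.
Proof. by have := rle_meet x y (rmeet x y); rewrite rle_refl => /esym/andP[]. Qed.

Lemma rle_tr y x z : x ≼ y -> y ≼ z -> x ≼ z.
Proof. exact: rle_trans. Qed.

Lemma rleD x y z t : x ≼ y -> z ≼ t -> x + z ≼ y + t.
Proof.
move=> xy zt; apply: (rle_tr (rleD2r z xy)).
by rewrite ![y + _]addrC; exact: rleD2r.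
Qed.

Lemma rleBlDr x y z : (x - y ≼ z) = (x ≼ z + y).
Proof.
by apply/idP/idP => [/(rleD2r y)|/(rleD2r (- y))]; rewrite ?subrK ?addrK.
Qed.

Lemma rleBrDr x y z : (x ≼ y - z) = (x + z ≼ y).
Proof.
by apply/idP/idP => [/(rleD2r z)|/(rleD2r (- z))]; rewrite ?subrK ?addrK.
Qed.

Lemma rsub_ge0 x y : (0 ≼ y - x) = (x ≼ y).
Proof. by rewrite rleBrDr add0r. Qed.

Lemma rleN x y : x ≼ y -> - y ≼ - x.
Proof. by rewrite -(rsub_ge0 x) -(rsub_ge0 (- y)) opprK addrC. Qed.

Lemma raddr_ge0 x y : 0 ≼ x -> 0 ≼ y -> 0 ≼ x + y.
Proof. by move=> x0 y0; rewrite -[0]addr0; exact: rleD. Qed.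

Lemma rpos_ge0 x : 0 ≼ rpos x. Proof. exact: rle_joinr. Qed.

Lemma rpos_ge x : x ≼ rpos x. Proof. exact: rle_joinl. Qed.

Lemma rpos_le x y : x ≼ y -> 0 ≼ y -> rpos x ≼ y.
Proof. by move=> xy y0; rewrite rjoin_le xy. Qed.

Lemma rposE x : x = rpos x - rpos (- x).
Proof.
apply/eqP; rewrite eq_sym subr_eq; apply/eqP/rle_anti/andP; split.
  apply: rpos_le.
    by rewrite -{1}[x]addr0; apply: rleD; [exact: rle_refl|exact: rpos_ge0].
  by rewrite addrC -[x]opprK rsub_ge0 opprK; exact: rpos_ge.
rewrite addrC -rleBrDr; apply: rpos_le.
  by rewrite rleBrDr addNr; exact: rpos_ge0.
by rewrite rsub_ge0; exact: rpos_ge.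
Qed.

Lemma rabs_ge0 x : 0 ≼ rabs x.
Proof.
have h : 0 ≼ rabs x + rabs x.
  by rewrite -(subrr x); apply: rleD; [exact: rle_joinl|exact: rle_joinr].
have -> : rabs x = 2^-1 *: (rabs x + rabs x).
  by rewrite scalerDr -scalerDl -[2^-1]mul1r -splitr scale1r.
by apply: rscale_ge0 => //; rewrite invr_ge0.
Qed.

Lemma rabs_id x : 0 ≼ x -> rabs x = x.
Proof.
move=> x0; apply: rle_anti; rewrite rle_joinl andbT rjoin_le rle_refl/=.
by apply: (rle_tr _ x0); rewrite -oppr0; exact: rleN.
Qed.

Lemma rabsN x : rabs (- x) = rabs x.
Proof.
by apply: rle_anti; rewrite /rabs !rjoin_le !opprK !rle_joinl !rle_joinr.
Qed.

Lemma rpos_le_abs x : rpos x ≼ rabs x.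
Proof. by apply: rpos_le; [exact: rle_joinl|exact: rabs_ge0]. Qed.

Lemma rscale_le (a : R) x y : 0 <= a -> x ≼ y -> a *: x ≼ a *: y.
Proof. by move=> a0 xy; rewrite -rsub_ge0 -scalerBr rscale_ge0// rsub_ge0. Qed.

Lemma rabsE x : rabs x = rpos x + rpos (- x).
Proof.
have half y : 2^-1 *: (y + y) = y :> E.
  by rewrite scalerDr -scalerDl -[2^-1]mul1r -splitr scale1r.
have h0 : 0 <= 2^-1 :> R by rewrite invr_ge0.
have le y : rpos y ≼ 2^-1 *: (y + rabs y).
  apply: rpos_le.
    by rewrite -{1}[y]half scalerDr [X in _ ≼ X]scalerDr rleD ?rle_refl//
      rscale_le// rle_joinl.
  by apply: rscale_ge0 => //; rewrite -(subrr y) rleD ?rle_refl ?rle_joinr.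
apply: rle_anti; apply/andP; split.
  rewrite rjoin_le; apply/andP; split.
    by rewrite -{1}[x]addr0 rleD ?rpos_ge ?rpos_ge0.
  by rewrite -{1}[- x]add0r rleD ?rpos_ge ?rpos_ge0.
apply: (rle_tr (rleD (le x) (le (- x)))).
by rewrite rabsN -scalerDr addrACA subrr add0r half rle_refl.
Qed.

Lemma riesz_decomposition x y z : 0 ≼ x -> 0 ≼ y -> 0 ≼ z -> z ≼ x + y ->
  exists a b, [/\ z = a + b, 0 ≼ a, a ≼ x, 0 ≼ b & b ≼ y].
Proof.
move=> x0 y0 z0 zxy; exists (rmeet z x), (z - rmeet z x); split.
- by rewrite addrC subrK.
- by rewrite rle_meet z0.
- exact: rmeet_ler.
- by rewrite rsub_ge0 rmeet_lel.
- rewrite rleBlDr addrC -rleBlDr rle_meet !rleBlDr zxy andbT.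
  by rewrite -{1}[z]addr0; apply: rleD => //; exact: rle_refl.
Qed.

End riesz_theory.

Section banach_lattice_theory.
Context {R : realType} {E : banachLatticeType R}.
Implicit Types x y z : E.

Lemma norm_rabs x : `|rabs x| = `|x|.
Proof.
have h : rabs (rabs x) = rabs x by rewrite rabs_id ?rabs_ge0.
by apply/eqP; rewrite eq_le !ler_norm_rabs ?h ?rle_refl.
Qed.

Lemma ler_norm_ge0 x y : 0 ≼ x -> x ≼ y -> `|x| <= `|y|.
Proof.
move=> x0 xy; apply: ler_norm_rabs; rewrite !rabs_id//.
exact: (rle_tr x0 xy).
Qed.

Lemma norm_rpos x : `|rpos x| <= `|x|.
Proof.
by rewrite -(norm_rabs x) ler_norm_ge0 ?rpos_ge0 ?rpos_le_abs.
Qed.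

Lemma cvg_rge0 (u_ : nat -> E) (u : E) :
  (\forall n \near \oo, 0 ≼ u_ n) -> u_ @ \oo --> u -> 0 ≼ u.
Proof.
move=> u0 uu.
suff h : rpos (- u) = 0.
  by rewrite [u]rposE h subr0; exact: rpos_ge0.
apply/normr0_eq0/eqP; rewrite eq_le normr_ge0 andbT; apply/ler_addgt0Pl => e e0.
rewrite addr0.
move/cvgrPdist_le : uu => /(_ _ e0) => ue.
near \oo => n.
have un : 0 ≼ u_ n by near: n.
have uen : `|u - u_ n| <= e by near: n.
apply: (le_trans _ uen); rewrite distrC; apply: (le_trans _ (norm_rpos _)).
apply: ler_norm_ge0; first exact: rpos_ge0.
apply: rpos_le; last exact: rpos_ge0.
apply: (rle_tr _ (rpos_ge _)).
by rewrite -{1}[- u]add0r; exact: rleD2r.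
Unshelve. all: by end_near. Qed.

End banach_lattice_theory.

Section dual.
Context {R : realType} (E : normedModType R).

(* Codomain R^o is R seen as a normed module over itself. *)
Definition dual_pred : {pred E -> R^o} :=
  mem [set f : E -> R^o | linear f /\ continuous f].

Record dual := Dual { dual_fun :> E -> R^o ; _ : dual_fun \in dual_pred }.
HB.instance Definition _ := [isSub for dual_fun].
HB.instance Definition _ := [Choice of dual by <:].

Lemma dual_subsemimod : subsemimod_closed dual_pred.
Proof.
split; first split.
- rewrite inE; split; last exact: cst_continuous.
  by move=> a x y /=; rewrite scaler0 addr0.
- move=> f g; rewrite !inE => -[lf cf] [lg cg]; split.
    by move=> a x y; rewrite !fctE lf lg scalerDr addrACA.
  by move=> x; apply: cvgD; [exact: cf|exact: cg].
- move=> a f; rewrite !inE => -[lf cf]; split.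
    move=> b x y; rewrite !fctE lf scalerDr !scalerA; congr (_ + _).
    by rewrite mulrC.
  by move=> x; apply: cvgZr; exact: cf.
Qed.

HB.instance Definition _ :=
  GRing.SubChoice_isSubLmodule.Build R (E -> R^o) dual_pred dual
    dual_subsemimod.

Lemma dual_linear (f : dual) : linear f.
Proof. by case: f => f /=; rewrite inE => -[]. Qed.

HB.instance Definition _ (f : dual) :=
  GRing.isLinear.Build R E R^o _ f (dual_linear f).

Lemma dual_continuous (f : dual) : continuous f.
Proof. by case: f => f /=; rewrite inE => -[]. Qed.

Lemma dualP (f g : dual) : (forall x, f x = g x) -> f = g.
Proof. by move=> fg; apply/val_inj/funext. Qed.

Lemma dualDE (f g : dual) x : (f + g) x = f x + g x. Proof. by []. Qed.
Lemma dualNE (f : dual) x : (- f) x = - f x. Proof. by []. Qed.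
Lemma dualZE (a : R) (f : dual) x : (a *: f) x = a * f x. Proof. by []. Qed.
Lemma dual0E x : (0 : dual) x = 0. Proof. by []. Qed.

Lemma bounded_dual_subproof (f : E -> R^o) (lf : linear f)
  (bf : exists M : R, forall x, `|f x| <= M * `|x|) : f \in dual_pred.
Proof.
rewrite inE; split=> //.
pose g : {linear E -> R^o} := HB.pack f (GRing.isLinear.Build R E R^o _ f lf).
rewrite -[f]/(g : E -> R^o); apply: bounded_linear_continuous.
apply/linear_boundedP; case: bf => M fM; near=> r => x.
by rewrite (le_trans (fM x))// ler_wpM2r//; near: r; exact: nbhs_pinfty_ge (num_real M).
Unshelve. all: by end_near. Qed.

Definition bounded_dual f lf bf := Dual (@bounded_dual_subproof f lf bf).

Definition dual_norm (f : dual) : R :=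
  sup [set `|f x| | x in [set x | `|x| <= 1]].

Lemma dual_bounded (f : dual) : exists M : R, forall x, `|f x| <= M * `|x|.
Proof.
have : bounded_near f (nbhs (0 : E)).
  by apply/linear_bounded_continuous; exact: dual_continuous.
move=> /linear_boundedP/pinfty_ex_gt0[M _ fM]; by exists M.
Qed.

Lemma dual_has_sup (f : dual) :
  has_sup [set `|f x| | x in [set x | `|x| <= 1]].
Proof.
split; first by exists `|f 0|, 0 => //=; rewrite normr0.
have [M fM] := dual_bounded f; exists `|M| => _ [x /= x1 <-].
rewrite (le_trans (fM x))// (le_trans (ler_wpM2r _ (ler_norm M)))//.
by rewrite -[leRHS]mulr1 ler_wpM2l.
Qed.

Lemma dual_norm_ge0 f : 0 <= dual_norm f.
Proof.
apply: le_trans (normr_ge0 (f 0)) _; apply: ub_le_sup.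
  by case: (dual_has_sup f).
by exists 0 => //=; rewrite normr0.
Qed.

Lemma dual_norm_apply (f : dual) x : `|f x| <= dual_norm f * `|x|.
Proof.
have [->|x0] := eqVneq x 0; first by rewrite linear0 !normr0 mulr0.
have nx0 : 0 < `|x| by rewrite normr_gt0.
rewrite -ler_pdivrMr// (_ : _ / _ = `|f (`|x|^-1 *: x)|); last first.
  by rewrite linearZ /= normrZ ger0_norm ?invr_ge0// mulrC.
apply: ub_le_sup; first by case: (dual_has_sup f).
by exists (`|x|^-1 *: x) => //=; rewrite normfZV.
Qed.

Lemma dual_norm_le (f : dual) (M : R) :
  (forall x, `|x| <= 1 -> `|f x| <= M) -> dual_norm f <= M.
Proof.
move=> fM; apply: ge_sup; first by case: (dual_has_sup f).
by move=> _ [x /= x1 <-]; exact: fM.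
Qed.

Lemma dual_norm_leM (f : dual) (M : R) : 0 <= M ->
  (forall x, `|f x| <= M * `|x|) -> dual_norm f <= M.
Proof.
move=> M0 fM; apply: dual_norm_le => x x1; rewrite (le_trans (fM x))//.
by rewrite -[leRHS]mulr1 ler_wpM2l.
Qed.

Let dual_normD f g : dual_norm (f + g) <= dual_norm f + dual_norm g.
Proof.
apply: dual_norm_leM => [|x]; first by rewrite addr_ge0 ?dual_norm_ge0.
by rewrite mulrDl (le_trans (ler_normD _ _))// lerD// dual_norm_apply.
Qed.

Let dual_normZ (a : R) (f : dual) : dual_norm (a *: f) = `|a| * dual_norm f.
Proof.
have le b g : dual_norm (b *: g) <= `|b| * dual_norm g.
  apply: dual_norm_leM => [|x]; first by rewrite mulr_ge0 ?dual_norm_ge0.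
  by rewrite dualZE normrM -mulrA ler_wpM2l// dual_norm_apply.
apply/eqP; rewrite eq_le le/=.
have [->|a0] := eqVneq a 0; first by rewrite normr0 mul0r dual_norm_ge0.
rewrite -ler_pdivlMl ?normr_gt0// -normfV.
by rewrite -{1}[f](scalerK a0) le.
Qed.

Let dual_norm0_eq0 f : dual_norm f = 0 -> f = 0.
Proof.
move=> f0; apply: dualP => x; apply/normr0_eq0/eqP.
by rewrite eq_le normr_ge0 andbT (le_trans (dual_norm_apply f x))// f0 mul0r.
Qed.

HB.instance Definition _ :=
  Lmodule_isNormed.Build R dual dual_normD dual_normZ dual_norm0_eq0.

Lemma dual_normE (f : dual) :
  `|f| = sup [set `|f x| | x in [set x | `|x| <= 1]].
Proof. by []. Qed.

Lemma ler_dual_apply (f : dual) x : `|f x| <= `|f| * `|x|.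
Proof. exact: dual_norm_apply. Qed.

Lemma ler_dual_norm (f : dual) (M : R) : 0 <= M ->
  (forall x, `|f x| <= M * `|x|) -> `|f| <= M.
Proof. exact: dual_norm_leM. Qed.

Let dual_complete (F : set_system dual) :
  ProperFilter F -> cauchy F -> cvg F.
Proof.
move=> FF Fc.
have Fc' : forall e : R, 0 < e -> exists f : dual, F (ball f e).
  by move/cauchyP : Fc.
have cx x : cvg ((fun f : dual => f x) @ F).
  apply/cauchy_cvgP/cauchyP => /= e e0.
  have e1 : 0 < e / (`|x| + 1) by rewrite divr_gt0// ltr_wpDl.
  have [f Ff] := Fc' _ e1.
  exists (f x); rewrite -[_ (ball _ _)]/(F [set g : dual | ball (f x : R^o) e (g x)]).
  apply: filterS Ff => g; rewrite -!ball_normE /= => fg.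
  rewrite -[_ - _]/((f - g) x) (le_lt_trans (ler_dual_apply _ _))//.
  rewrite (@le_lt_trans _ _ (`|f - g| * (`|x| + 1)))//.
    by rewrite ler_wpM2l// lerDl.
  by rewrite -ltr_pdivlMr// ltr_wpDl.
pose l (x : E) : R^o := lim ((fun f : dual => f x) @ F).
have ll : linear l.
  move=> a x y; apply/cvg_lim => //.
  rewrite (_ : (fun f : dual => f (a *: x + y)) = (fun f => a *: f x + f y)).
    by apply: cvgD; [apply: cvgZr; exact: cx|exact: cx].
  by apply/funext => f; rewrite linearP.
have key (e : R) (f : dual) : F (ball f e) ->
    forall x, `|f x - l x| <= e * `|x|.
  move=> Ff x; apply/ler_addgt0Pr => d d0.
  have /cvgrPdist_le/(_ _ d0) lx : (fun g : dual => g x) @ F --> l x.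
    exact: cx.
  near F => g.
  have fg : `|f - g| <= e.
    have : ball f e g by near: g.
    by rewrite -ball_normE /= => /ltW.
  rewrite -[f x](subrK (g x)) -addrA (le_trans (ler_normD _ _))// lerD//.
    rewrite -[_ - _]/((f - g) x) (le_trans (ler_dual_apply _ _))//.
    by rewrite ler_wpM2r.
  by rewrite distrC; near: g.
have bl : exists M : R, forall x, `|l x| <= M * `|x|.
  have [f Ff] := Fc' 1 ltr01.
  exists (`|f| + 1) => x; rewrite -[l x](subrK (f x)) addrC mulrDl.
  by rewrite (le_trans (ler_normD _ _))// lerD ?ler_dual_apply// distrC key.
apply/cvg_ex; exists (bounded_dual ll bl); apply/cvgrPdist_le => e e0.
have e2 : 0 < e / 2 by rewrite divr_gt0.
have [f Ff] := Fc' _ e2.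
apply: filterS (Ff) => g; rewrite -ball_normE /= => /ltW fg.
apply: ler_dual_norm; first exact: ltW.
move=> x; rewrite dualDE dualNE /= -[l x](subrK (f x)) -addrA [e]splitr mulrDl.
rewrite (le_trans (ler_normD _ _))// lerD//.
  by rewrite distrC key.
rewrite -[_ - _]/((f - g) x) (le_trans (ler_dual_apply _ _))//.
by rewrite ler_wpM2r.
Unshelve. all: by end_near. Qed.

HB.instance Definition _ := Uniform_isComplete.Build dual dual_complete.

End dual.

Section dual_lattice.
Context {R : realType} (E : banachLatticeType R).
Implicit Types (f g h : dual E) (x y z : E).

Definition dual_le : rel (dual E) :=
  fun f g => `[< forall x : E, 0 ≼ x -> f x <= g x >].

Let dual_le_refl : reflexive dual_le.
Proof. by move=> f; apply/asboolP. Qed.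

Let dual_le_anti : antisymmetric dual_le.
Proof.
move=> f g /andP[/asboolP fg /asboolP gf]; apply: dualP => x.
have key y : 0 ≼ y -> f y = g y.
  by move=> y0; apply/eqP; rewrite eq_le fg ?gf.
by rewrite [x]rposE !linearB/= !key ?rpos_ge0.
Qed.

Let dual_le_trans : transitive dual_le.
Proof.
move=> g f h /asboolP fg /asboolP gh; apply/asboolP => x x0.
exact: le_trans (fg _ x0) (gh _ x0).
Qed.

Let dual_leD2r h f g : dual_le f g -> dual_le (f + h) (g + h).
Proof. by move=> /asboolP fg; apply/asboolP => x x0; rewrite lerD2r fg. Qed.

Let dual_scale_ge0 (a : R) f : 0 <= a -> dual_le 0 f -> dual_le 0 (a *: f).
Proof.
by move=> a0 /asboolP f0; apply/asboolP => x x0; rewrite mulr_ge0// f0.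
Qed.

Section positive_part.
Variable f : dual E.

Let s x : R := sup [set f y | y in [set y | 0 ≼ y /\ y ≼ x]].

Let s_has_sup x : 0 ≼ x -> has_sup [set f y | y in [set y | 0 ≼ y /\ y ≼ x]].
Proof.
move=> x0; split.
  by exists (f 0), 0 => //=; split => //; exact: rle_refl.
exists (`|f| * `|x|) => _ [y /= [y0 yx] <-].
rewrite (le_trans (ler_norm _))// (le_trans (ler_dual_apply _ _))//.
by rewrite ler_wpM2l// ler_norm_ge0.
Qed.

Let s_ge x y : 0 ≼ y -> y ≼ x -> f y <= s x.
Proof.
move=> y0 yx; apply: ub_le_sup; last by exists y.
by case: (s_has_sup (rle_tr y0 yx)).
Qed.

Let s_le x (M : R) : 0 ≼ x -> (forall y, 0 ≼ y -> y ≼ x -> f y <= M) ->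
  s x <= M.
Proof.
move=> x0 fM; apply: ge_sup; first by case: (s_has_sup x0).
by move=> _ [y /= [y0 yx] <-]; exact: fM.
Qed.

Let s_ge0 x : 0 ≼ x -> 0 <= s x.
Proof. by move=> x0; rewrite -(linear0 f) s_ge// rle_refl. Qed.

Let sD x y : 0 ≼ x -> 0 ≼ y -> s (x + y) = s x + s y.
Proof.
move=> x0 y0; apply/eqP; rewrite eq_le; apply/andP; split.
  apply: s_le; first exact: raddr_ge0.
  move=> z z0 zxy.
  have [a [b [-> a0 ax b0 by_]]] := riesz_decomposition x0 y0 z0 zxy.
  by rewrite linearD/= lerD// s_ge.
rewrite -lerBrDr; apply: s_le => // a a0 ax.
rewrite lerBrDr addrC -lerBrDr; apply: s_le => // b b0 by_.
rewrite lerBrDr addrC -linearD s_ge ?raddr_ge0//; exact: rleD.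
Qed.

Let sZ_le (a : R) x : 0 < a -> 0 ≼ x -> s (a *: x) <= a * s x.
Proof.
move=> a0 x0; apply: s_le => [|y y0 yx]; first by apply: rscale_ge0 => //; exact: ltW.
rewrite -ler_pdivrMl//; have -> : a^-1 * f y = f (a^-1 *: y) by rewrite linearZ.
have ai : 0 <= a^-1 by rewrite invr_ge0 ltW.
apply: s_ge; first exact: rscale_ge0.
by have := rscale_le ai yx; rewrite scalerK ?gt_eqF.
Qed.

Let sZ (a : R) x : 0 <= a -> 0 ≼ x -> s (a *: x) = a * s x.
Proof.
rewrite le_eqVlt => /predU1P[<-|a0] x0.
  rewrite scale0r mul0r; apply/eqP; rewrite eq_le s_ge0 ?rle_refl// andbT.
  apply: s_le => [|y y0 y0']; first exact: rle_refl.
  suff -> : y = 0 by rewrite linear0.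
  by apply: rle_anti; rewrite y0 y0'.
apply/eqP; rewrite eq_le sZ_le//=.
rewrite -ler_pdivlMl// -{1}[x](scalerK (lt0r_neq0 a0)) sZ_le ?invr_gt0//.
by apply: rscale_ge0 => //; exact: ltW.
Qed.

Let p x : R^o := s (rpos x) - s (rpos (- x)).

Let pB x y : 0 ≼ x -> 0 ≼ y -> p (x - y) = s x - s y.
Proof.
move=> x0 y0; apply/eqP; rewrite /p subr_eq addrAC eq_sym subr_eq -!sD ?rpos_ge0//.
apply/eqP; congr s; apply/eqP.
rewrite -subr_eq addrAC eq_sym -subr_eq eq_sym; apply/eqP; exact: rposE.
Qed.

Let p_linear : linear p.
Proof.
have pZ a x : p (a *: x) = a *: p x.
  have [a0|/ltW a0] := leP 0 a.
    rewrite {1}[x]rposE scalerBr pB ?rscale_ge0 ?rpos_ge0// !sZ ?rpos_ge0//.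
    by rewrite /p -mulrBr.
  have a0' : 0 <= - a by rewrite oppr_ge0.
  rewrite {1}[x]rposE -[a]opprK scaleNr scalerBr opprB.
  rewrite pB ?rscale_ge0 ?rpos_ge0// !sZ ?rpos_ge0//.
  by rewrite -mulrBr -opprB mulrN -scaleNr.
move=> a x y; rewrite -pZ; move: (a *: x) => {}x.
rewrite {1}[x]rposE {1}[y]rposE addrACA -opprD.
by rewrite pB ?raddr_ge0 ?rpos_ge0// !sD ?rpos_ge0// opprD addrACA.
Qed.

Let p_bounded : exists M : R, forall x, `|p x| <= M * `|x|.
Proof.
have key x y : `|y| <= `|x| -> 0 ≼ y -> `|s y| <= `|f| * `|x|.
  move=> yx y0; rewrite ger0_norm ?s_ge0//; apply: s_le => // z z0 zy.
  rewrite (le_trans (ler_norm _))// (le_trans (ler_dual_apply _ _))//.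
  by rewrite ler_wpM2l// (le_trans _ yx)// ler_norm_ge0.
exists (`|f| + `|f|) => x; rewrite mulrDl /p (le_trans (ler_normB _ _))//.
apply: lerD; apply: key; rewrite ?rpos_ge0 ?norm_rpos//.
by rewrite -[leRHS]normrN norm_rpos.
Qed.

Definition dual_pos : dual E := bounded_dual p_linear p_bounded.

Lemma dual_posE x : 0 ≼ x ->
  dual_pos x = sup [set f y | y in [set y | 0 ≼ y /\ y ≼ x]].
Proof.
move=> x0; have := pB x0 (rle_refl 0); rewrite subr0 => px.
have s0 : s 0 = 0 by rewrite -(scale0r (0 : E)) sZ ?rle_refl// mul0r.
by rewrite s0 subr0 in px.
Qed.

Let s_dual_pos x : 0 ≼ x -> dual_pos x = s x. Proof. exact: dual_posE. Qed.

Lemma dual_pos_ge x y : 0 ≼ y -> y ≼ x -> f y <= dual_pos x.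
Proof. by move=> y0 yx; rewrite s_dual_pos ?s_ge//; exact: (rle_tr y0 yx). Qed.

Lemma dual_pos_le x (M : R) : 0 ≼ x ->
  (forall y, 0 ≼ y -> y ≼ x -> f y <= M) -> dual_pos x <= M.
Proof. by move=> x0 fM; rewrite s_dual_pos// s_le. Qed.

End positive_part.

(* Riesz-Kantorovich: f v g = g + (f - g)^+, where for x >= 0
   (f - g)^+ x = sup {(f - g) y | 0 <= y <= x}; see dual_posE. *)
Definition dual_join f g : dual E := g + dual_pos (f - g).

Definition dual_meet f g : dual E := - dual_join (- f) (- g).

Let dual_join_le f g h : dual_le (dual_join f g) h = dual_le f h && dual_le g h.
Proof.
apply/asboolP/andP => [fgh|[/asboolP fh /asboolP gh] x x0].
  split; apply/asboolP => x x0; apply: le_trans (fgh x x0); rewrite dualDE.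
    by rewrite addrC -lerBlDr -[_ - _]/((f - g) x) dual_pos_ge// rle_refl.
  by rewrite lerDl -(linear0 (f - g)) dual_pos_ge// rle_refl.
rewrite dualDE addrC -lerBrDr -[X in _ <= X]/((h - g) x).
apply: dual_pos_le => // y y0 yx.
apply: (@le_trans _ _ ((h - g) y)); first by rewrite lerB// fh.
rewrite -subr_ge0 -linearB subr_ge0 gh// rsub_ge0//.
Qed.

Let dual_leN f g : dual_le (- f) (- g) = dual_le g f.
Proof.
by apply/asboolP/asboolP => fg x /fg; rewrite ?dualNE ?lerN2.
Qed.

Let dual_le_meet f g h : dual_le h (dual_meet f g) = dual_le h f && dual_le h g.
Proof. by rewrite -[h]opprK dual_leN dual_join_le opprK !dual_leN. Qed.

HB.instance Definition _ := Lmodule_isRiesz.Build R (dual E)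
  dual_le_refl dual_le_anti dual_le_trans dual_leD2r dual_scale_ge0
  dual_join_le dual_le_meet.

Lemma dual_leP f g : reflect (forall x, 0 ≼ x -> f x <= g x) (f ≼ g).
Proof. exact: asboolP. Qed.

Lemma ler_dual_rabs f x : `|f x| <= rabs f (rabs x).
Proof.
have key y : 0 ≼ y -> `|f y| <= rabs f y.
  move=> y0; rewrite ler_norml lerNl -dualNE.
  by rewrite (dual_leP _ _ (rle_joinl f (- f)))// (dual_leP _ _ (rle_joinr f (- f))).
rewrite (rabsE x) {1}[x]rposE linearB linearD.
by rewrite (le_trans (ler_normB _ _))// lerD// key// rpos_ge0.
Qed.

Let dual_norm_rabs f g : rabs f ≼ rabs g -> `|f| <= `|g|.
Proof.
move=> fg; apply: ler_dual_norm => // x.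
apply: (le_trans (ler_dual_rabs _ _)).
apply: (le_trans (dual_leP _ _ fg _ (rabs_ge0 x))).
have -> : rabs g = - g + dual_pos (g - - g) by [].
rewrite dualDE addrC -lerBrDr; apply: dual_pos_le => [|y y0 yx].
  exact: rabs_ge0.
rewrite lerBrDr -[_ y]/(g y - - g y) opprK.
rewrite -!linearD -linearB.
rewrite (le_trans (ler_norm _))// (le_trans (ler_dual_apply _ _))//.
rewrite ler_wpM2l// -(norm_rabs x).
apply: ler_norm_rabs; rewrite [rabs (rabs x)]rabs_id ?rabs_ge0// rjoin_le.
rewrite opprB !rleBlDr !rleD//=.
by rewrite -{1}[rabs x]addr0 rleD ?rle_refl ?raddr_ge0.
Qed.

HB.instance Definition _ :=
  CompleteNormed_Riesz_isBanachLattice.Build R (dual E) dual_norm_rabs.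

End dual_lattice.

Arguments bounded_dual : simpl never.
Arguments dual_le : simpl never.
Arguments dual_pos : simpl never.
Arguments dual_join : simpl never.
Arguments dual_meet : simpl never.

Notation bidual E := (dual (dual E)).

(* The weak topology sigma(E, E'). *)
Definition weak_topology (R : realType) (E : normedModType R) : Type :=
  initial_topology (fun x : E => (fun f : dual E => f x) : {ptws dual E -> R^o}).

HB.instance Definition _ (R : realType) (E : normedModType R) :=
  Uniform.on (weak_topology E).

(* The weak* topology sigma(E', E), carried by dual E. *)
Definition weak_star_topology (R : realType) (E : normedModType R) : Type :=
  initial_topology (fun f : dual E => (f : {ptws E -> R^o})).

HB.instance Definition _ (R : realType) (E : normedModType R) :=
  Uniform.on (weak_star_topology E).

Lemma cvg_weak_star (R : realType) (E : normedModType R)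
    (f_ : nat -> weak_star_topology E) (f : weak_star_topology E) :
  f_ @ \oo --> f <->
  forall x : E, (f_ n : dual E) x @[n --> \oo] --> (f : dual E) x.
Proof.
pose v (f : dual E) : {ptws E -> R^o} := f.
have vE : v \o f_ @ \oo --> v f <->
    forall x : E, (f_ n : dual E) x @[n --> \oo] --> (f : dual E) x.
  exact: (@pointwise_cvgP _ _ (v \o f_ @ \oo) (v f)).
rewrite -vE; split => [ff|vf].
  apply: (cvg_comp _ _ ff); exact: initial_continuous.
move=> U [_ [[V oV <-] Vf VU]].
have h : \forall n \near \oo, V (v (f_ n)).
  exact: (vf V (open_nbhs_nbhs (conj oV Vf))).
suff : \forall n \near \oo, U (f_ n) by [].
by apply: filterS h => n Vn; exact: VU.
Qed.

Definition separable (T : topologicalType) :=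
  exists2 D : set T, countable D & dense D.

Definition weakly_compact (R : realType) (E F : normedModType R)
    (T : {linear E -> F}) :=
  precompact ([set T x | x in [set x : E | `|x| <= 1]] : set (weak_topology F)).

Definition arens_regular (R : realType) (E : completeNormedModType R) :=
  forall T : {linear E -> dual E}, continuous T -> weakly_compact T.

Definition weak_star_seq_continuous_lattice_ops (R : realType)
    (F : banachLatticeType R) :=
  forall (y_ : nat -> bidual F) (y : bidual F),
    y_ @ \oo --> (y : weak_star_topology (dual F)) ->
    rabs (y_ n) @[n --> \oo] --> (rabs y : weak_star_topology (dual F)).

Section bilinear.
Context {R : realType} {E1 E2 F : banachLatticeType R}.
Implicit Types A : {bilinear E1 -> E2 -> F}.

Definition positive_bilinear A :=
  forall x1 x2, 0 ≼ x1 -> 0 ≼ x2 -> 0 ≼ A x1 x2.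

Definition regular_bilinear A :=
  exists P Q : {bilinear E1 -> E2 -> F},
    [/\ positive_bilinear P, positive_bilinear Q &
        forall x1 x2, A x1 x2 = P x1 x2 - Q x1 x2].

(* A maps products of order bounded sets to order bounded sets. *)
Definition order_bounded_bilinear A :=
  forall (a1 b1 : E1) (a2 b2 : E2), exists u v : F, forall x1 x2,
    a1 ≼ x1 -> x1 ≼ b1 -> a2 ≼ x2 -> x2 ≼ b2 -> u ≼ A x1 x2 /\ A x1 x2 ≼ v.

Definition disjointness_preserving A :=
  [/\ order_bounded_bilinear A,
      forall x1 x2 y2, disjoint_vectors x2 y2 ->
        disjoint_vectors (A x1 x2) (A x1 y2) &
      forall x2 x1 y1, disjoint_vectors x1 y1 ->
        disjoint_vectors (A x1 x2) (A y1 x2)].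

Lemma positive_bilinear_bounded A : positive_bilinear A ->
  exists M : R, 0 <= M /\ forall x1 x2, `|A x1 x2| <= M * `|x1| * `|x2|.
Proof.
move=> A0.
suff [M M0 AM] : exists2 M : R, 0 <= M & forall x1 x2, 0 ≼ x1 -> 0 ≼ x2 ->
    `|A x1 x2| <= M * `|x1| * `|x2|.
  have AM' x1 x2 : 0 ≼ x2 -> `|A x1 x2| <= (M + M) * `|x1| * `|x2|.
    move=> x20; rewrite [x1 in A x1]rposE linearBl (le_trans (ler_normB _ _))//.
    rewrite !mulrDl lerD// (le_trans (AM _ _ _ _))// ?rpos_ge0// !ler_wpM2r//.
      by rewrite ler_wpM2l// norm_rpos.
    by rewrite ler_wpM2l// -[leRHS]normrN norm_rpos.
  exists ((M + M) + (M + M)); split; first by rewrite !addr_ge0.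
  move=> x1 x2; rewrite [x2 in A _ x2]rposE linearBr (le_trans (ler_normB _ _))//.
  rewrite [_ * `|x1|]mulrDl mulrDl lerD// (le_trans (AM' _ _ _))// ?rpos_ge0//.
    by rewrite ler_wpM2l ?mulr_ge0 ?addr_ge0// norm_rpos.
  by rewrite ler_wpM2l ?mulr_ge0 ?addr_ge0// -[leRHS]normrN norm_rpos.
apply: contrapT => nAM.
have bad n : exists p : E1 * E2, [/\ 0 ≼ p.1, 0 ≼ p.2, `|p.1| <= 2^-1 ^+ n,
    `|p.2| <= 2^-1 ^+ n & n%:R < `|A p.1 p.2|].
  have [x [y [x0 y0 nxy]]] : exists x y, [/\ 0 ≼ x, 0 ≼ y &
      n%:R * (2 ^+ n * 2 ^+ n) * `|x| * `|y| < `|A x y|].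
    apply: contrapT => nxy; apply: nAM; exists (n%:R * (2 ^+ n * 2 ^+ n)).
      by rewrite !mulr_ge0 ?exprn_ge0.
    by move=> x y x0 y0; rewrite leNgt; apply/negP => ?; apply: nxy; exists x, y.
  have xn0 : x != 0.
    by apply: contraTneq nxy => ->; rewrite linear0l !normr0 mulr0 mul0r ltxx.
  have yn0 : y != 0.
    by apply: contraTneq nxy => ->; rewrite linear0r !normr0 mulr0 ltxx.
  have h0 : 0 <= 2^-1 ^+ n :> R by rewrite exprn_ge0 ?invr_ge0.
  exists (2^-1 ^+ n *: (`|x|^-1 *: x), 2^-1 ^+ n *: (`|y|^-1 *: y)); split => /=.
  - by rewrite !rscale_ge0 ?invr_ge0.
  - by rewrite !rscale_ge0 ?invr_ge0.
  - by rewrite normrZ normfZV// mulr1 ger0_norm.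
  - by rewrite normrZ normfZV// mulr1 ger0_norm.
  - have a0 : `|x| != 0 by rewrite normr_eq0.
    have b0 : `|y| != 0 by rewrite normr_eq0.
    have c0 : 2 ^+ n != 0 :> R by rewrite expf_neq0 ?pnatr_eq0.
    rewrite !linearZl_LR !linearZr_LR/= !normrZ !normfV !normr_id.
    rewrite ger0_norm// exprVn.
    rewrite [ltRHS](_ : _ = `|A x y| / (2 ^+ n * 2 ^+ n * `|x| * `|y|)).
      by rewrite ltr_pdivlMr ?mulr_gt0 ?exprn_gt0 ?normr_gt0// !mulrA in nxy *.
    by field; rewrite a0 b0 c0.
have [p pP] := choice bad.
have sum_cvg (E : completeNormedModType R) (u_ : nat -> E) :
    (forall n, `|u_ n| <= 2^-1 ^+ n) -> cvgn (series u_).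
  move=> u2; apply: normed_cvg.
  apply: (@series_le_cvg _ _ (geometric 1 2^-1)) => //= [k|k|].
  - by rewrite mul1r exprn_ge0 ?invr_ge0.
  - by rewrite mul1r.
  - by apply: is_cvg_geometric_series; rewrite ger0_norm ?invr_ge0// invf_lt1 ?ltr1n.
have sum_ge (E : banachLatticeType R) (u_ : nat -> E) :
    (forall n, 0 ≼ u_ n) -> cvgn (series u_) ->
    forall n, u_ n ≼ lim (series u_ @ \oo).
  move=> u0 uc n; rewrite -rsub_ge0.
  apply: (@cvg_rge0 _ _ (fun k => series u_ k - u_ n)); last first.
    by apply: cvgB => //; exact: cvg_cst.
  near=> k.
  have nk : (n < k)%N by near: k; exact: nbhs_infty_gt.
  rewrite seriesEord/= (bigD1 (Ordinal nk))//= addrAC subrr add0r.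
  by elim/big_ind: _ => //; [exact: rle_refl|exact: raddr_ge0].
have c1 : cvgn (series (fun n => (p n).1)).
  by apply: sum_cvg => n; case: (pP n).
have c2 : cvgn (series (fun n => (p n).2)).
  by apply: sum_cvg => n; case: (pP n).
set X := lim (series (fun n => (p n).1) @ \oo) in c1.
set Y := lim (series (fun n => (p n).2) @ \oo) in c2.
have X1 n : (p n).1 ≼ X by apply: (sum_ge _ (fun n => (p n).1)) => // k; case: (pP k).
have Y2 n : (p n).2 ≼ Y by apply: (sum_ge _ (fun n => (p n).2)) => // k; case: (pP k).
pose n := (Num.truncn `|A X Y|).+1.
have [p1 p2 _ _] := pP n; apply/negP; rewrite -leNgt.
apply: (@le_trans _ _ `|A X Y|); last by rewrite ltW// truncnS_gt.
apply: ler_norm_ge0; first exact: A0.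
apply: (@rle_tr _ _ (A X (p n).2)).
  by rewrite -rsub_ge0 -linearBl A0// rsub_ge0.
by rewrite -rsub_ge0 -linearBr A0 ?rsub_ge0// (rle_tr p1).
Unshelve. all: by end_near. Qed.

Lemma regular_bilinear_bounded A : regular_bilinear A ->
  exists M : R, 0 <= M /\ forall x1 x2, `|A x1 x2| <= M * `|x1| * `|x2|.
Proof.
move=> [P [Q [/positive_bilinear_bounded[M [M0 PM]]
  /positive_bilinear_bounded[N [N0 QN]] APQ]]].
exists (M + N); split; first exact: addr_ge0.
move=> x1 x2; rewrite APQ !mulrDl (le_trans (ler_normB _ _))//.
exact: lerD.
Qed.

End bilinear.

Section arens.
Context {R : realType} {E1 E2 F : banachLatticeType R}.
Variables (A : {bilinear E1 -> E2 -> F}) (regA : regular_bilinear A).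

Section partial.
Variable f : dual F.

Let l_linear x1 : linear (fun x2 => f (A x1 x2) : R^o).
Proof. by move=> a x y; rewrite linearPr linearP. Qed.

Let l_bounded x1 : exists M : R, forall x2, `|f (A x1 x2)| <= M * `|x2|.
Proof.
have [M [M0 AM]] := regular_bilinear_bounded regA.
exists (`|f| * (M * `|x1|)) => x2; rewrite (le_trans (ler_dual_apply _ _))//.
by rewrite -mulrA ler_wpM2l.
Qed.

(* f \o A(x1, -) *)
Definition comp_left x1 : dual E2 := bounded_dual (l_linear x1) (l_bounded x1).

Let r_linear x2 : linear (fun x1 => f (A x1 x2) : R^o).
Proof. by move=> a x y; rewrite linearPl linearP. Qed.

Let r_bounded x2 : exists M : R, forall x1, `|f (A x1 x2)| <= M * `|x1|.
Proof.
have [M [M0 AM]] := regular_bilinear_bounded regA.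
exists (`|f| * (M * `|x2|)) => x1; rewrite (le_trans (ler_dual_apply _ _))//.
by rewrite -mulrA ler_wpM2l// mulrAC.
Qed.

(* f \o A(-, x2) *)
Definition comp_right x2 : dual E1 := bounded_dual (r_linear x2) (r_bounded x2).

End partial.

Lemma comp_left_norm : exists M : R, 0 <= M /\
  forall f x1, `|comp_left f x1| <= M * `|f| * `|x1|.
Proof.
have [M [M0 AM]] := regular_bilinear_bounded regA.
exists M; split=> // f x1; apply: ler_dual_norm => [|x2].
  by rewrite !mulr_ge0.
rewrite (le_trans (ler_dual_apply f (A x1 x2)))//.
by rewrite [M * _]mulrC -!mulrA ler_wpM2l// mulrA.
Qed.

Lemma comp_right_norm : exists M : R, 0 <= M /\
  forall f x2, `|comp_right f x2| <= M * `|f| * `|x2|.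
Proof.
have [M [M0 AM]] := regular_bilinear_bounded regA.
exists M; split=> // f x2; apply: ler_dual_norm => [|x1].
  by rewrite !mulr_ge0.
rewrite (le_trans (ler_dual_apply f (A x1 x2)))//.
by rewrite [M * _]mulrC -!mulrA ler_wpM2l// [`|x2| * _]mulrC mulrA.
Qed.

Lemma comp_left_linearr x1 : linear (comp_left^~ x1).
Proof. by move=> a f g; apply: dualP. Qed.

Lemma comp_left_linear f : linear (comp_left f).
Proof.
move=> a x y; apply: dualP => z.
by rewrite -[LHS]/(f (A _ z)) linearPl linearP.
Qed.

Lemma comp_right_linearr x2 : linear (comp_right^~ x2).
Proof. by move=> a f g; apply: dualP. Qed.

Lemma comp_right_linear f : linear (comp_right f).
Proof.
move=> a x y; apply: dualP => z.
by rewrite -[LHS]/(f (A z _)) linearPr linearP.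
Qed.

Section theta.

Section inner.
Variables (y2 : bidual E2) (f : dual F).

Let inner_linear : linear (fun x1 => y2 (comp_left f x1) : R^o).
Proof. by move=> a x y; rewrite comp_left_linear linearP. Qed.

Let inner_bounded : exists M : R, forall x1, `|y2 (comp_left f x1)| <= M * `|x1|.
Proof.
have [M [M0 bM]] := comp_left_norm; exists (`|y2| * (M * `|f|)) => x1.
by rewrite (le_trans (ler_dual_apply _ _))// -mulrA ler_wpM2l.
Qed.

Definition arens_theta_inner : dual E1 :=
  bounded_dual inner_linear inner_bounded.

End inner.

Lemma arens_theta_inner_linear y2 : linear (arens_theta_inner y2).
Proof.
move=> a f g; apply: dualP => x1.
by rewrite -[LHS]/(y2 (comp_left _ x1)) comp_left_linearr linearP.
Qed.

Variables (y1 : bidual E1) (y2 : bidual E2).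

Let outer_linear : linear (fun f => y1 (arens_theta_inner y2 f) : R^o).
Proof. by move=> a f g; rewrite arens_theta_inner_linear linearP. Qed.

Let outer_bounded :
  exists M : R, forall f, `|y1 (arens_theta_inner y2 f)| <= M * `|f|.
Proof.
have [M [M0 bM]] := comp_left_norm; exists (`|y1| * (`|y2| * M)) => f.
rewrite (le_trans (ler_dual_apply _ _))// -mulrA ler_wpM2l//.
apply: ler_dual_norm => [|x1]; first by rewrite !mulr_ge0.
by rewrite (le_trans (ler_dual_apply y2 _))// -!mulrA ler_wpM2l// mulrA.
Qed.

Definition arens_theta : bidual F := bounded_dual outer_linear outer_bounded.

End theta.

Section id.

Section inner.
Variables (y1 : bidual E1) (f : dual F).

Let inner_linear : linear (fun x2 => y1 (comp_right f x2) : R^o).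
Proof. by move=> a x y; rewrite comp_right_linear linearP. Qed.

Let inner_bounded : exists M : R, forall x2, `|y1 (comp_right f x2)| <= M * `|x2|.
Proof.
have [M [M0 bM]] := comp_right_norm; exists (`|y1| * (M * `|f|)) => x2.
by rewrite (le_trans (ler_dual_apply _ _))// -mulrA ler_wpM2l.
Qed.

Definition arens_id_inner : dual E2 :=
  bounded_dual inner_linear inner_bounded.

End inner.

Lemma arens_id_inner_linear y1 : linear (arens_id_inner y1).
Proof.
move=> a f g; apply: dualP => x2.
by rewrite -[LHS]/(y1 (comp_right _ x2)) comp_right_linearr linearP.
Qed.

Variables (y1 : bidual E1) (y2 : bidual E2).

Let outer_linear : linear (fun f => y2 (arens_id_inner y1 f) : R^o).
Proof. by move=> a f g; rewrite arens_id_inner_linear linearP. Qed.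

Let outer_bounded :
  exists M : R, forall f, `|y2 (arens_id_inner y1 f)| <= M * `|f|.
Proof.
have [M [M0 bM]] := comp_right_norm; exists (`|y2| * (`|y1| * M)) => f.
rewrite (le_trans (ler_dual_apply _ _))// -mulrA ler_wpM2l//.
apply: ler_dual_norm => [|x2]; first by rewrite !mulr_ge0.
by rewrite (le_trans (ler_dual_apply y1 _))// -!mulrA ler_wpM2l// mulrA.
Qed.

Definition arens_id : bidual F := bounded_dual outer_linear outer_bounded.

End id.

Lemma comp_leftE f x1 x2 : comp_left f x1 x2 = f (A x1 x2).
Proof. by []. Qed.

Lemma comp_rightE f x2 x1 : comp_right f x2 x1 = f (A x1 x2).
Proof. by []. Qed.

Lemma arens_theta_innerE y2 f x1 :
  arens_theta_inner y2 f x1 = y2 (comp_left f x1).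
Proof. by []. Qed.

Lemma arens_thetaE y1 y2 f :
  arens_theta y1 y2 f = y1 (arens_theta_inner y2 f).
Proof. by []. Qed.

Lemma arens_id_innerE y1 f x2 :
  arens_id_inner y1 f x2 = y1 (comp_right f x2).
Proof. by []. Qed.

Lemma arens_idE y1 y2 f : arens_id y1 y2 f = y2 (arens_id_inner y1 f).
Proof. by []. Qed.

Lemma arens_theta_bilinear : bilinear_for *:%R *:%R arens_theta.
Proof.
split=> [y2 a y y'|y1 a y y']; apply: dualP => f //.
rewrite -[LHS]/(y1 (arens_theta_inner _ f)).
rewrite (_ : arens_theta_inner _ _ =
    a *: arens_theta_inner y f + arens_theta_inner y' f) ?linearP//.
exact: dualP.
Qed.

HB.instance Definition _ := bilinear_isBilinear.Build R
  (bidual E1) (bidual E2) (bidual F) *:%R *:%R arens_theta arens_theta_bilinear.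

Lemma arens_id_bilinear : bilinear_for *:%R *:%R arens_id.
Proof.
split=> [y2 a y y'|y1 a y y']; apply: dualP => f //.
rewrite -[LHS]/(y2 (arens_id_inner _ f)).
rewrite (_ : arens_id_inner _ _ =
    a *: arens_id_inner y f + arens_id_inner y' f) ?linearP//.
exact: dualP.
Qed.

HB.instance Definition _ := bilinear_isBilinear.Build R
  (bidual E1) (bidual E2) (bidual F) *:%R *:%R arens_id arens_id_bilinear.

End arens.

(* Main.v *)
(* Uniqueness: since E^* is separable, Goldstine's theorem yields a bounded
   sequence x_n in E converging weak* to y1. For f in F^*, the operator
   T : x |-> f \o A(x, -) is weakly compact, so (T x_n) has a weak cluster point
   g in E^*, and both Arens extensions take the value y2(g) at (y1, y2) and f.

   Disjointness: for x in E, the restriction of the extension to {x} x E^** is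
   the biadjoint of A(x, -). By Meyer's theorem, the modulus H of a disjointness
   preserving T is a lattice homomorphism with H x = |T x| for x >= 0; the adjoint
   of H is interval preserving by Hahn-Banach, so H^** is a lattice homomorphism,
   and it dominates |T^**|. Hence T^** preserves disjointness. Finally,
   the extension at (y1, u) is the weak* limit of its values at (x_n, u), and
   disjointness passes to weak* limits of sequences because |a| /\ |b| = 0 is the
   same as | |a| - |b| | = |a| + |b|. *)
Require Import Defs.
From HB Require Import structures.
From mathcomp Require Import all_boot all_order all_algebra.
From mathcomp Require Import all_classical reals topology normedtype sequences.
From mathcomp Require Import lra.
Set Implicit Arguments.
Unset Strict Implicit.
Unset Printing Implicit Defensive.
Import Order.TTheory GRing.Theory Num.Theory.
Import numFieldNormedType.Exports.
Local Open Scope classical_set_scope.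
Local Open Scope ring_scope.

(* Linearity with the operations of R instead of those of R^o, which are
   convertible but which rewriting does not identify. *)
Section scalar_valued.
Context {R : realType} {V : lmodType R} (f : {linear V -> R^o}).

Lemma lin0 : f 0 = 0 :> R. Proof. exact: linear0. Qed.
Lemma linD x y : f (x + y) = f x + f y :> R. Proof. exact: linearD. Qed.
Lemma linN x : f (- x) = - f x :> R. Proof. exact: linearN. Qed.
Lemma linB x y : f (x - y) = f x - f y :> R. Proof. exact: linearB. Qed.
Lemma linZ (a : R) x : f (a *: x) = a * f x :> R. Proof. exact: linearZ. Qed.

End scalar_valued.

(** With this linear map, domination along a single line becomes a case of domination along the
    range of a linear map. *)
Definition line (R : realType) (V : lmodType R) (v : V) (a : R^o) : V := a *: v.

Fact line_is_linear (R : realType) (V : lmodType R) (v : V) : linear (line v).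
Proof. by move=> a b c; rewrite /line scalerDl scalerA. Qed.

HB.instance Definition _ (R : realType) (V : lmodType R) (v : V) :=
  GRing.isLinear.Build R R^o V _ (line v) (line_is_linear v).

(** * The Hahn-Banach theorem *)

Section hahn_banach.
Context {R : realType}.

Definition sublinear (V : lmodType R) (p : V -> R) :=
  (forall x y, p (x + y) <= p x + p y) /\
  (forall (a : R) x, 0 <= a -> p (a *: x) = a * p x).

Lemma sublinear0 (V : lmodType R) (p : V -> R) : sublinear p -> p 0 = 0.
Proof. by move=> [_ pZ]; rewrite -(scale0r (0 : V)) pZ// mul0r. Qed.

Lemma sublinear_geN (V : lmodType R) (p : V -> R) x :
  sublinear p -> - p (- x) <= p x.
Proof.
by move=> sp; rewrite lerNl -subr_ge0 opprK addrC -(sublinear0 sp) -(subrr x);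
  case: sp.
Qed.

(** The hypothesis for [a^-1] at [a *: x] is the reverse inequality; for functionals defined as
    infima only one direction is then left to check. *)
Lemma sublinear_homo_le (V : lmodType R) (p : V -> R) : p 0 = 0 ->
  (forall (a : R) x, 0 < a -> p (a *: x) <= a * p x) ->
  forall (a : R) x, 0 <= a -> p (a *: x) = a * p x.
Proof.
move=> p0 pZ a x; rewrite le_eqVlt => /predU1P[<-|a0].
  by rewrite scale0r mul0r.
apply/eqP; rewrite eq_le pZ//= -ler_pdivlMl//.
by rewrite -{1}[x](scalerK (lt0r_neq0 a0)) pZ// invr_gt0.
Qed.

Lemma sublinear_scale_le (V : lmodType R) (p : V -> R) (v : V) (a : R) :
  sublinear p -> a * p v <= p (a *: v).
Proof.
move=> sp; have [_ pZ] := sp.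
have [a0|/ltW a0] := leP 0 a; first by rewrite pZ.
rewrite -[a]opprK scaleNr mulNr (le_trans _ (sublinear_geN _ sp))// opprK.
by rewrite lerN2 pZ ?oppr_ge0.
Qed.

Section inf_extension.
Variables (U V : lmodType R) (p : V -> R) (H : {linear U -> V})
  (psi : {linear U -> R^o}).
Hypotheses (sp : sublinear p) (psip : forall u, psi u <= p (H u)).

(* Every linear f with f <= inf_ext satisfies both f <= p and f \o H = psi. *)
Definition inf_ext x : R := inf [set p (x + H u) - (psi u : R) | u in setT].

Let inf_ext_has_inf x : has_inf [set p (x + H u) - (psi u : R) | u in setT].
Proof.
split; first by exists (p (x + H 0) - (psi 0 : R)), 0.
exists (- p (- x)) => _ [u _ <-].
rewrite lerBrDr addrC (le_trans (lerB (psip u) (lexx _)))//.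
rewrite lerBlDr; case: sp => /(_ (x + H u) (- x)) h _.
by rewrite addrAC subrr add0r in h.
Qed.

Lemma inf_ext_lb x u : inf_ext x <= p (x + H u) - (psi u : R).
Proof. by apply: inf_lbound; [case: (inf_ext_has_inf x)|exists u]. Qed.

Let inf_ext_ge x (M : R) :
  (forall u, M <= p (x + H u) - (psi u : R)) -> M <= inf_ext x.
Proof.
move=> hM; apply: lb_le_inf; first by case: (inf_ext_has_inf x).
by move=> _ [u _ <-].
Qed.

Lemma inf_ext_le x : inf_ext x <= p x.
Proof.
have := inf_ext_lb x 0.
by rewrite linear0 lin0 addr0 subr0.
Qed.

Lemma inf_ext_range u : inf_ext (H u) <= psi u.
Proof.
have := inf_ext_lb (H u) (- u).
by rewrite linearN linN subrr (sublinear0 sp) sub0r opprK.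
Qed.

Lemma sublinear_inf_ext : sublinear inf_ext.
Proof.
have [pD pZ] := sp.
split=> [x y|].
  rewrite -lerBlDr; apply: inf_ext_ge => u.
  rewrite lerBlDr -lerBlDl; apply: inf_ext_ge => v.
  rewrite lerBlDl (le_trans (inf_ext_lb _ (u + v)))//.
  by rewrite linearD linD/= opprD [leRHS]addrACA lerD2r addrACA pD.
apply: sublinear_homo_le => [|a x a0].
  apply/eqP; rewrite eq_le (le_trans (inf_ext_le _)) ?(sublinear0 sp)//=.
  by apply: inf_ext_ge => u; rewrite add0r subr_ge0.
rewrite -ler_pdivrMl//. apply: inf_ext_ge => u.
rewrite ler_pdivrMl// (le_trans (inf_ext_lb _ (a *: u)))//.
by rewrite linearZ linZ/= -scalerDr pZ ?(ltW a0)// mulrBr.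
Qed.

End inf_extension.

(* A minimal sublinear functional is linear: it equals its inf_ext along every
   line. *)
Section koenig.
Variables (V : lmodType R) (p : V -> R) (sp : sublinear p).

Let below := {q : V -> R | sublinear q /\ forall x, q x <= p x}.
(** The order is reversed, so that a maximal element in Zorn's lemma is a minimal functional. *)
Let ge_on (s t : below) : bool := `[< forall x, sval t x <= sval s x >].

(** The pointwise infimum of the chain works: it is finite because every member is at least
    [- p (- x)] at [x], and it is subadditive because the smaller of two members can serve both
    arguments. *)
Let below_chain (A : set below) :
  total_on A ge_on -> exists t, forall s, A s -> ge_on s t.
Proof.
move=> Atot; have [->|/set0P[s0 As0]] := eqVneq A set0.
  by exists (exist _ p (conj sp (fun=> lexx _))) => s.
pose q x := inf [set sval s x | s in A].
have hi x : has_inf [set sval s x | s in A].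
  split; first by exists (sval s0 x), s0.
  exists (- p (- x)) => _ [s As <-].
  have [ss sq] := svalP s.
  by rewrite (le_trans _ (sublinear_geN x ss))// lerN2.
have q_le x s : A s -> q x <= sval s x.
  by move=> As; apply: inf_lbound; [case: (hi x)|exists s].
have q_ge x M : (forall s, A s -> M <= sval s x) -> M <= q x.
  move=> hM; apply: lb_le_inf; first by case: (hi x).
  by move=> _ [s As <-]; exact: hM.
have sq : sublinear q.
  split=> [x y|].
    rewrite -lerBlDr; apply: (q_ge) => s As.
    rewrite lerBlDr -lerBlDl; apply: (q_ge) => t At.
    rewrite lerBlDl; have [[sD _] _] := svalP s; have [[tD _] _] := svalP t.
    case: (Atot _ _ As At) => /asboolP st.
      by rewrite (le_trans (q_le _ _ At))// (le_trans (tD _ _))// lerD2r.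
    by rewrite (le_trans (q_le _ _ As))// (le_trans (sD _ _))// lerD2l.
  apply: sublinear_homo_le => [|a x a0].
    apply/eqP; rewrite eq_le; apply/andP; split.
      have [ss0 _] := svalP s0.
      by rewrite -(sublinear0 ss0) q_le.
    by apply: (q_ge) => s As; have [ss _] := svalP s; rewrite (sublinear0 ss).
  rewrite -ler_pdivrMl//; apply: (q_ge) => s As.
  have [[_ sZ] _] := svalP s.
  by rewrite ler_pdivrMl// -sZ ?(ltW a0)// q_le.
have qp x : q x <= p x.
  by have [_ h] := svalP s0; rewrite (le_trans (q_le _ _ As0)).
by exists (exist _ q (conj sq qp)) => s As; apply/asboolP => x; exact: q_le.
Qed.

Lemma sublinear_dominates_linear :
  exists f : {linear V -> R^o}, forall x, f x <= p x.
Proof.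
have [] := @ZL_preorder below (exist _ p (conj sp (fun=> lexx _))) ge_on.
- by move=> t; apply/asboolP.
- move=> r s t /asboolP rs /asboolP st; apply/asboolP => x.
  exact: le_trans (st x) (rs x).
- exact: below_chain.
move=> [q [sq qp]] qmin.
have [qD qZ] := sq.
(* Minimality puts [q] below its [inf_ext] along the line of [v]; the parameter 1 on that line gives
   superadditivity. *)
have qB x v : q x <= q (x + v) - q v.
  have hv (u : R^o) : line (q v : R^o) u <= q (line v u) by exact: sublinear_scale_le.
  pose i := @inf_ext R^o V q (line v) (line (q v : R^o)).
  have si : sublinear i by exact: sublinear_inf_ext.
  have ip y : i y <= p y by exact: le_trans (inf_ext_le sq hv y) (qp y).
  have := qmin (exist _ i (conj si ip)).
  move=> /(_ (asboolT (inf_ext_le sq hv)))/asboolP/(_ x) /= qi.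
  rewrite (le_trans qi)// (le_trans (inf_ext_lb _ hv _ 1))//.
  by rewrite /= /line !scale1r.
have qDE x v : q (x + v) = q x + q v.
  by apply/eqP; rewrite eq_le qD -lerBrDr qB.
have qN x : q (- x) = - q x.
  by apply/eqP; rewrite -addr_eq0 -qDE addNr (sublinear0 sq).
have lq : linear (q : V -> R^o).
  move=> a x y; rewrite qDE; congr (_ + _).
  have [a0|/ltW a0] := leP 0 a; first by rewrite qZ.
  by rewrite -[a]opprK scaleNr qN qZ ?oppr_ge0// scaleNr.
pose f : {linear V -> R^o} :=
  HB.pack (q : V -> R^o) (GRing.isLinear.Build R V R^o _ (q : V -> R^o) lq).
by exists f; exact: qp.
Qed.

End koenig.

(** The range of [H] plays the role of the subspace; domination forces [psi] to vanish on the kernel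
    of [H]. A linear functional below [inf_ext] is at most [psi] along [H], and the same bound at
    [- u] gives equality. *)
Theorem hahn_banach (U V : lmodType R) (p : V -> R) (H : {linear U -> V})
    (psi : {linear U -> R^o}) :
  sublinear p -> (forall u, psi u <= p (H u)) ->
  exists f : {linear V -> R^o},
    (forall x, f x <= p x) /\ (forall u, f (H u) = psi u).
Proof.
move=> sp psip.
have [f fi] := sublinear_dominates_linear (sublinear_inf_ext sp psip).
have fH u : f (H u) <= psi u by exact: le_trans (fi _) (inf_ext_range sp psip u).
exists f; split=> [x|u]; first exact: le_trans (fi _) (inf_ext_le sp psip x).
by apply/eqP; rewrite eq_le fH/=; have := fH (- u); rewrite linearN !linN lerN2.
Qed.

Corollary sublinear_support (V : lmodType R) (p : V -> R) (v : V) :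
  sublinear p ->
  exists f : {linear V -> R^o}, (forall x, f x <= p x) /\ f v = p v.
Proof.
move=> sp.
have [f [fp fv]] := @hahn_banach R^o V p (line v) (line (p v : R^o)) sp
  (fun u => sublinear_scale_le v u sp).
by exists f; split=> //; have := fv 1; rewrite /= /line !scale1r.
Qed.

End hahn_banach.

(** * Riesz spaces and Meyer's theorem *)

Section riesz_identities.
Context {R : realType} {E : rieszSpaceType R}.
Implicit Types x y z a b c p e g : E.

Lemma rle_antisym x y : x ≼ y -> y ≼ x -> x = y.
Proof. by move=> xy yx; apply: rle_anti; rewrite xy yx. Qed.

Lemma rleD2rE z x y : (x + z ≼ y + z) = (x ≼ y).
Proof. by apply/idP/idP => [/(rleD2r (- z))|/rleD2r//]; rewrite !addrK. Qed.

Lemma rleD2lE z x y : (z + x ≼ z + y) = (x ≼ y).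
Proof. by rewrite ![z + _]addrC rleD2rE. Qed.

Lemma rleDl x y : 0 ≼ y -> x ≼ x + y.
Proof. by move=> y0; rewrite -{1}[x]addr0 rleD2lE. Qed.

Lemma rleDr x y : 0 ≼ y -> x ≼ y + x.
Proof. by rewrite addrC; exact: rleDl. Qed.

Lemma rleNE x y : (- x ≼ - y) = (y ≼ x).
Proof. by apply/idP/idP => [/rleN|/rleN//]; rewrite !opprK. Qed.

Lemma rmeetC x y : rmeet x y = rmeet y x.
Proof. by apply: rle_antisym; rewrite rle_meet rmeet_ler rmeet_lel. Qed.

Lemma rmeet_mono x y z t : x ≼ z -> y ≼ t -> rmeet x y ≼ rmeet z t.
Proof.
by move=> xz yt; rewrite rle_meet (rle_tr (rmeet_lel _ _) xz)
  (rle_tr (rmeet_ler _ _) yt).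
Qed.

Lemma rmeet_ge0 x y : 0 ≼ x -> 0 ≼ y -> 0 ≼ rmeet x y.
Proof. by move=> x0 y0; rewrite rle_meet x0. Qed.

Lemma rmeetDr x y z : rmeet (x + z) (y + z) = rmeet x y + z.
Proof.
apply: rle_antisym; last by rewrite rle_meet !rleD2rE rmeet_lel rmeet_ler.
by rewrite -rleBlDr rle_meet !rleBlDr rmeet_lel rmeet_ler.
Qed.

Lemma rmeetDl_le x y z : 0 ≼ z -> rmeet (x + z) y ≼ rmeet x y + z.
Proof. by move=> z0; rewrite -rmeetDr rmeet_mono ?rle_refl// rleDl. Qed.

Lemma rjoinDmeet x y : rjoin x y = x + y - rmeet x y.
Proof.
apply: rle_antisym.
  rewrite rjoin_le !rleBrDr rleD2lE rmeet_ler.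
  by rewrite [x + y]addrC rleD2lE rmeet_lel.
rewrite rleBlDr [X in _ ≼ X]addrC -rleBlDr rle_meet !rleBlDr.
by rewrite rleD2lE rle_joinr addrC rleD2lE rle_joinl.
Qed.

(** Each of [a] and [b] is recovered from its meet and join with [p]. Enlarging both terms to common
    bounds gives a bound on [rjoin a b], from which the join with [p] is cancelled. *)
Lemma rmeet_joinr p a b : rmeet p (rjoin a b) ≼ rjoin (rmeet p a) (rmeet p b).
Proof.
set z := rjoin (rmeet p a) _.
have key x : rmeet p x ≼ z -> x ≼ rjoin a b -> x ≼ z - p + rjoin p (rjoin a b).
  move=> xz xab.
  have -> : x = rmeet p x - p + rjoin p x.
    by rewrite rjoinDmeet addrA subrKA addrAC subrr add0r.
  apply: rleD; first exact: rleD2r.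
  by rewrite rjoin_le rle_joinl (rle_tr xab (rle_joinr _ _)).
have : rjoin a b ≼ z - p + rjoin p (rjoin a b).
  by rewrite rjoin_le !key ?rle_joinl ?rle_joinr.
rewrite [X in _ + X]rjoinDmeet addrA subrKA rleBrDr.
by rewrite addrC rleD2rE.
Qed.

Lemma rsub_meet x y : x - rmeet x y = rpos (x - y).
Proof.
apply: rle_antisym; last first.
  by rewrite rjoin_le rsub_ge0 rmeet_lel andbT rleD2lE rleNE rmeet_ler.
rewrite rleBlDr [X in _ ≼ X]addrC -rleBlDr rle_meet rleBlDr rleDl ?rpos_ge0//=.
by rewrite rleBlDr [X in _ ≼ X]addrC -rleBlDr rpos_ge.
Qed.

Lemma rabs_sub x y : rabs (x - y) = x + y - rmeet x y *+ 2.
Proof.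
rewrite rabsE opprB -!rsub_meet [rmeet y x]rmeetC addrACA mulr2n.
by rewrite -opprD.
Qed.

Lemma rabs_triangle x y : rabs (x + y) ≼ rabs x + rabs y.
Proof.
rewrite rjoin_le rleD ?rle_joinl//=.
by rewrite opprD rleD ?rle_joinr.
Qed.

Lemma rabs_le x y : (rabs x ≼ y) = (x ≼ y) && (- x ≼ y).
Proof. exact: rjoin_le. Qed.

Lemma rmeet_pos_neg x : rmeet (rpos x) (rpos (- x)) = 0.
Proof.
have := rsub_meet (rpos x) (rpos (- x)); rewrite -rposE => /eqP.
by rewrite subr_eq addrC -subr_eq subrr => /eqP.
Qed.

Lemma rmeet0_le a b x y : rmeet x y = 0 -> 0 ≼ a -> a ≼ x -> 0 ≼ b -> b ≼ y ->
  rmeet a b = 0.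
Proof.
move=> xy a0 ax b0 by_; apply: rle_antisym; last exact: rmeet_ge0.
by rewrite -xy rmeet_mono.
Qed.

Lemma rmeet0D a b c : 0 ≼ a -> 0 ≼ b -> 0 ≼ c ->
  rmeet a c = 0 -> rmeet b c = 0 -> rmeet (a + b) c = 0.
Proof.
move=> a0 b0 c0 ac bc.
apply: rle_antisym; last by rewrite rmeet_ge0 ?raddr_ge0.
rewrite -[X in _ ≼ X]ac rle_meet rmeet_ler andbT.
rewrite -{2}[a]addr0 -bc addrC [X in _ ≼ X]addrC -rmeetDr rmeet_mono//.
  exact: rle_refl.
exact: rleDl.
Qed.

Lemma rabs_sub_disjoint x y : rmeet x y = 0 -> rabs (x - y) = x + y.
Proof. by move=> xy; rewrite rabs_sub xy mul0rn subr0. Qed.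

Lemma rposD_le x y : rpos (x + y) ≼ rpos x + rpos y.
Proof. by apply: rpos_le; rewrite ?raddr_ge0 ?rleD ?rpos_ge ?rpos_ge0. Qed.

Lemma rposZ_le (a : R) x : 0 <= a -> rpos (a *: x) ≼ a *: rpos x.
Proof.
by move=> a0; apply: rpos_le; rewrite ?rscale_le ?rscale_ge0 ?rpos_ge ?rpos_ge0.
Qed.

Lemma rpos_le0 x : x ≼ 0 -> rpos x = 0.
Proof.
by move=> x0; apply: rle_antisym; rewrite ?rpos_ge0// rpos_le ?rle_refl.
Qed.

Lemma rabsZ (a : R) x : 0 <= a -> rabs (a *: x) = a *: rabs x.
Proof.
rewrite le_eqVlt => /predU1P[<-|a0].
  by rewrite !scale0r rabs_id// rle_refl.
have le (b : R) y : 0 <= b -> rabs (b *: y) ≼ b *: rabs y.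
  by move=> b0; rewrite rabs_le -scalerN !rscale_le ?rle_joinl ?rle_joinr.
apply: rle_antisym; first exact/le/ltW.
rewrite -[X in _ ≼ X](scalerKV (lt0r_neq0 a0)) rscale_le ?ltW//.
by rewrite -{1}[x](scalerK (lt0r_neq0 a0)) le// invr_ge0 ltW.
Qed.

(* Disjointness expressed with absolute values and sums only, so that it passes
   to limits along which rabs is continuous. *)
Lemma disjoint_vectorsE x y :
  disjoint_vectors x y <-> rabs (rabs x - rabs y) = rabs x + rabs y.
Proof.
rewrite /disjoint_vectors rabs_sub; split=> [->|/eqP].
  by rewrite mul0rn subr0.
rewrite -subr_eq0 addrAC subrr add0r oppr_eq0.
by rewrite -scaler_nat scaler_eq0 pnatr_eq0 => /eqP.
Qed.

End riesz_identities.

(** * Meyer's theorem: additivity of the modulus on the positive cone *)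

Section meyer.
Context {R : realType}.

Lemma rmeet0Z (E : rieszSpaceType R) (t : R) (a b : E) : 0 <= t ->
  0 ≼ a -> 0 ≼ b -> rmeet a b = 0 -> rmeet (t *: a) b = 0.
Proof.
move=> t0 a0 b0 ab; set z := rmeet _ _.
have z0 : 0 ≼ z by rewrite rmeet_ge0// rscale_ge0.
(* Both [t] and 1 are at most [t + 1], so dividing by it brings [z] below [a] and below [b] at
   once. *)
have s0 : 0 < t + 1 by rewrite ltr_wpDl.
have s0' : 0 <= (t + 1)^-1 by rewrite invr_ge0 ltW.
have : (t + 1)^-1 *: z ≼ rmeet a b.
  rewrite rle_meet; apply/andP; split.
    rewrite -[a](scalerK (lt0r_neq0 s0)) rscale_le//.
    rewrite (rle_tr (rmeet_lel _ _))// scalerDl scale1r.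
    exact: rleDl.
  rewrite -[b](scalerK (lt0r_neq0 s0)) rscale_le//.
  rewrite (rle_tr (rmeet_ler _ _))// scalerDl scale1r.
  by rewrite rleDr// rscale_ge0.
rewrite ab => /(rscale_le (ltW s0)).
rewrite scalerKV ?lt0r_neq0// scaler0 => zle.
exact: rle_antisym.
Qed.

(** The positive part of [u] is at most that of [u - t *: v] plus [t *: rpos v], and the last term
    is disjoint from the negative part of [v]. *)
Lemma rmeet_pos_neg_le (E : rieszSpaceType R) (t : R) (u v : E) : 0 <= t ->
  rmeet (rpos u) (rpos (- v)) ≼ rabs (u - t *: v).
Proof.
move=> t0.
have uv : rpos u ≼ rpos (u - t *: v) + t *: rpos v.
  apply: rpos_le.
    rewrite -{1}[u](subrK (t *: v)) rleD ?rpos_ge// rscale_le//; exact: rpos_ge.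
  by rewrite raddr_ge0 ?rpos_ge0// rscale_ge0// rpos_ge0.
apply: (rle_tr (rmeet_mono uv (rle_refl _))).
rewrite addrC (rle_tr (rmeetDl_le _ _ _)) ?rpos_ge0//.
by rewrite rmeet0Z ?rpos_ge0 ?rmeet_pos_neg// add0r rpos_le_abs.
Qed.

Lemma banach_lattice_archimedean (F : banachLatticeType R) (p g : F) : 0 ≼ p ->
  (forall n : nat, p ≼ n.+1%:R^-1 *: g) -> p = 0.
Proof.
move=> p0 pg; apply/normr0_eq0/eqP; rewrite eq_le normr_ge0 andbT leNgt.
apply/negP => np.
pose n := Num.truncn (`|g| / `|p|).
have : `|p| <= n.+1%:R^-1 * `|g|.
  have n0 : 0 <= n.+1%:R^-1 :> R by rewrite invr_ge0.
  by rewrite -[X in X * _](ger0_norm n0) -normrZ ler_norm_ge0.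
rewrite ler_pdivlMl ?ltr0n// -ler_pdivlMr//; apply/negP; rewrite -ltNge.
exact: truncnS_gt.
Qed.

Context {E F : banachLatticeType R} (T G : {linear E -> F}).
Hypothesis TG : forall x, 0 ≼ x -> rabs (T x) ≼ G x.

Lemma dominated_ge0 x : 0 ≼ x -> 0 ≼ G x.
Proof. by move=> x0; rewrite (rle_tr (rabs_ge0 (T x)))// TG. Qed.

Lemma dominated_rabs x z : rabs x ≼ z -> rabs (T x) ≼ G z.
Proof.
move=> xz; rewrite [x]rposE linearB (rle_tr (rabs_triangle _ _))// rabsN.
rewrite (rle_tr (rleD (TG (rpos_ge0 _)) (TG (rpos_ge0 _))))//.
by rewrite -linearD -rabsE -rsub_ge0 -linearB dominated_ge0// rsub_ge0.
Qed.

Hypothesis Tdp : forall x y, disjoint_vectors x y -> disjoint_vectors (T x) (T y).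

Lemma dp_rmeet x y : 0 ≼ x -> 0 ≼ y -> rmeet x y = 0 ->
  rmeet (rabs (T x)) (rabs (T y)) = 0.
Proof. by move=> x0 y0 xy; apply: Tdp; rewrite /disjoint_vectors !rabs_id. Qed.

(* For functionals, T (x - t *: y)^+ and T (x - t *: y)^- cannot both be nonzero;
   the first one does not vanish at t = 0 and vanishes for large t, so by
   continuity both vanish for some t, and T x = t *: T y. Below, t runs through
   multiples of a small d, and the choice of t is replaced by an induction
   showing that p is dominated by a t up to the error d *: G y. *)
Section opposite_signs.
Variables (x y : E).
Hypotheses (x0 : 0 ≼ x) (y0 : 0 ≼ y).

Let p := rmeet (rpos (T x)) (rpos (- T y)).
Let pp (t : R) := rpos (x - t *: y).
Let nn (t : R) := rpos (- (x - t *: y)).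
Let a t := rabs (T (pp t)).
Let b t := rabs (T (nn t)).

Let ab t : rmeet (a t) (b t) = 0.
Proof. by apply: dp_rmeet; rewrite ?rpos_ge0// rmeet_pos_neg. Qed.

Let p_le (t : R) : 0 <= t -> p ≼ rabs (T (x - t *: y)).
Proof.
by move=> t0; rewrite linearB linearZ; exact: rmeet_pos_neg_le.
Qed.

Let p_le_join (t : R) : 0 <= t -> p ≼ rjoin (a t) (b t).
Proof.
move=> t0; rewrite (rle_tr (p_le t0))// rjoinDmeet ab subr0.
rewrite [X in T X]rposE linearB (rle_tr (rabs_triangle _ _))// rabsN.
exact: rle_refl.
Qed.

Let a_step (t d : R) : 0 <= d -> a t ≼ a (t + d) + d *: G y.
Proof.
move=> d0; have dy0 : 0 ≼ d *: y by rewrite rscale_ge0.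
rewrite /a -[pp t](subrK (pp (t + d))) linearD.
rewrite (rle_tr (rabs_triangle _ _))// addrC rleD2lE -linearZ/=.
apply: dominated_rabs; rewrite rabs_le opprB !rleBlDr.
have -> : pp (t + d) = rpos (x - t *: y - d *: y).
  by rewrite /pp scalerDl opprD addrA.
rewrite /pp; move: (x - t *: y) => w; apply/andP; split.
  apply: rpos_le; last by rewrite raddr_ge0// rpos_ge0.
  by rewrite addrC -rleBlDr rpos_ge.
apply: rpos_le; last by rewrite raddr_ge0// rpos_ge0.
have wdy : w - d *: y ≼ w by rewrite rleBlDr rleDl.
by rewrite (rle_tr wdy)// (rle_tr (rpos_ge w))// rleDr.
Qed.

Let p_le_a (d : R) (k : nat) : 0 <= d ->
  p ≼ rjoin (d *: G y) (a (k%:R * d)).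
Proof.
move=> d0; have e0 : 0 ≼ d *: G y by rewrite rscale_ge0// dominated_ge0.
elim: k => [|k IH].
  rewrite mul0r (rle_tr (p_le_join (lexx 0)))// rjoin_le rle_joinr/=.
  rewrite (rle_tr _ (rle_joinl _ _))//.
  have -> : b 0 = 0; last exact: e0.
  rewrite /b /nn scale0r subr0.
  rewrite rpos_le0; last by rewrite -oppr0 rleNE.
  by rewrite linear0 rabs_id// rle_refl.
set t := k%:R * d in IH *.
have -> : k.+1%:R * d = t + d by rewrite -natr1 mulrDl mul1r.
have t0 : 0 <= t + d by rewrite addr_ge0// mulr_ge0.
have pj : p ≼ rmeet p (rjoin (a (t + d)) (b (t + d))).
  by rewrite rle_meet rle_refl p_le_join.
rewrite (rle_tr pj)// (rle_tr (rmeet_joinr _ _ _))// rjoin_le; apply/andP; split.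
  by rewrite (rle_tr (rmeet_ler _ _))// rle_joinr.
rewrite (rle_tr _ (rle_joinl _ _))//.
(* The part of [p] under [b (t + d)] is also under this sum, whose first term is disjoint from
   [b (t + d)]; only the error survives. *)
have pa : p ≼ a (t + d) + d *: G y.
  by rewrite (rle_tr IH)// rjoin_le a_step// andbT rleDr// rabs_ge0.
rewrite (rle_tr (rmeet_mono pa (rle_refl _)))//.
by rewrite (rle_tr (rmeetDl_le _ _ e0))// ab add0r rle_refl.
Qed.

Lemma dp_opposite_signs : rmeet (rpos (T x)) (rpos (- T y)) = 0.
Proof.
rewrite -/p.
have Gx0 := dominated_ge0 x0; have Gy0 := dominated_ge0 y0.
have p0 : 0 ≼ p by rewrite rmeet_ge0 ?rpos_ge0.
apply: (@banach_lattice_archimedean _ _ (G y + (G x + G x))) => // n.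
set m : R := n.+1%:R; set d := m^-1.
have m0 : 0 < m by rewrite ltr0n.
have d0 : 0 <= d by rewrite invr_ge0 ltW.
have d1 : d <= 1 by rewrite invf_le1// ler1n.
have e0 : 0 ≼ d *: G y by rewrite rscale_ge0.
have pa : p ≼ a m + d *: G y.
  (* Reaching [t = m] in steps of length [d = 1 / m] takes [m] squared steps. *)
  have -> : m = (n.+1 * n.+1)%:R * d by rewrite natrM mulfK// lt0r_neq0.
  rewrite (rle_tr (p_le_a (n.+1 * n.+1) d0))// rjoin_le rleDr ?rabs_ge0//=.
  exact: rleDl.
have aG : a m ≼ G x.
  apply: dominated_rabs; rewrite rabs_id ?rpos_ge0//.
  apply: rpos_le => //; rewrite rleBlDr rleDl// rscale_ge0//; exact: ltW.
have pb : p ≼ d *: b m + d *: (G x + G x).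
  apply: (rle_tr (rmeet_ler _ _)); apply: (rle_tr (rpos_le_abs _)); rewrite rabsN.
  (* Since [x - m *: y] is [pp m - nn m], solving for [y] leaves [nn m] as main term; the other two
     cost at most [G x] each, scaled by [d]. *)
  have -> : T y = d *: (T (nn m) - T (pp m) + T x).
    rewrite -linearB -linearD -linearZ; congr (T _).
    rewrite -opprB -(rposE (x - m *: y)) opprB subrK scalerA mulVf ?scale1r//.
    exact: lt0r_neq0.
  rewrite rabsZ// -scalerDr rscale_le//.
  rewrite addrA (rle_tr (rabs_triangle _ _))// rleD// ?TG//.
  by rewrite (rle_tr (rabs_triangle _ _))// rabsN rleD// rle_refl.
have dG0 : 0 ≼ d *: (G x + G x) by rewrite rscale_ge0// raddr_ge0.
(* The main terms [a m] and [d *: b m] are disjoint, so [p] is at most the sum of the two errors,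
   which is of order [d]. *)
have : p ≼ rmeet (a m + d *: G y) (d *: b m + d *: (G x + G x)).
  by rewrite rle_meet pa.
move/rle_tr; apply; apply: (rle_tr (rmeetDl_le _ _ e0)).
rewrite rmeetC (scalerDr d (G y)) [X in _ ≼ X]addrC rleD2rE.
apply: (rle_tr (rmeetDl_le _ _ dG0)).
by rewrite rmeet0Z ?add0r ?rabs_ge0 ?rle_refl// rmeetC.
Qed.

End opposite_signs.

(** By [dp_opposite_signs], the sum of the positive parts of [T x] and [T y] is disjoint from the
    sum of their negative parts, so the modulus of the difference of these sums is their total. *)
Lemma dp_rabsD x y : 0 ≼ x -> 0 ≼ y ->
  rabs (T (x + y)) = rabs (T x) + rabs (T y).
Proof.
move=> x0 y0; rewrite linearD {1}[T x]rposE {1}[T y]rposE addrACA -opprD.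
rewrite rabs_sub_disjoint; first by rewrite !rabsE addrACA.
have key u v : 0 ≼ u -> 0 ≼ v -> rmeet (rpos (T u)) (rpos (- T v)) = 0.
  exact: dp_opposite_signs.
by rewrite rmeet0D ?raddr_ge0 ?rpos_ge0// rmeetC rmeet0D ?rpos_ge0// rmeetC key.
Qed.

End meyer.

(** * Biadjoints *)

Section adjoint.
Context {R : realType} {E F : normedModType R} (T : {linear E -> F}).
Hypothesis bT : exists M : R, forall x, `|T x| <= M * `|x|.

Let adj_linear (f : dual F) : linear (fun x => f (T x) : R^o).
Proof. by move=> a x y; rewrite !linearP. Qed.

Let adj_bounded (f : dual F) : exists M : R, forall x, `|f (T x)| <= M * `|x|.
Proof.
have [M TM] := bT; exists (`|f| * M) => x.
by rewrite (le_trans (ler_dual_apply _ _))// -mulrA ler_wpM2l.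
Qed.

Definition adjoint f : dual E := bounded_dual (adj_linear f) (adj_bounded f).

Lemma adjointE f x : adjoint f x = f (T x). Proof. by []. Qed.

Lemma adjoint_linear : linear adjoint.
Proof. by move=> a f g; apply: dualP. Qed.

Let biadj_linear (u : bidual E) : linear (fun f => u (adjoint f) : R^o).
Proof. by move=> a f g; rewrite adjoint_linear linearP. Qed.

Let biadj_bounded (u : bidual E) :
  exists M : R, forall f, `|u (adjoint f)| <= M * `|f|.
Proof.
have [M TM] := bT; exists (`|u| * `|M|) => f.
rewrite (le_trans (ler_dual_apply _ _))// -mulrA ler_wpM2l//.
apply: ler_dual_norm => [|x]; first by rewrite mulr_ge0.
rewrite (le_trans (ler_dual_apply f (T x)))// [`|M| * _]mulrC -mulrA ler_wpM2l//.
by rewrite (le_trans (TM x))// ler_wpM2r// ler_norm.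
Qed.

Definition biadjoint u : bidual F :=
  bounded_dual (biadj_linear u) (biadj_bounded u).

Lemma biadjointE u f : biadjoint u f = u (adjoint f). Proof. by []. Qed.

End adjoint.

Arguments adjoint : simpl never.
Arguments biadjoint : simpl never.

(** * Linear extension of additive maps on the positive cone *)

Section cone_extension.
Context {R : realType} {E : rieszSpaceType R} {F : lmodType R} (h : E -> F).
Hypotheses (hD : forall x y, 0 ≼ x -> 0 ≼ y -> h (x + y) = h x + h y)
  (hZ : forall (a : R) x, 0 <= a -> 0 ≼ x -> h (a *: x) = a *: h x).

(** Additivity makes [h x - h y] depend on [x - y] only, so the value may be computed from any
    decomposition into positive vectors. This turns the modulus in Meyer's theorem into an
    operator. *)
Lemma cone_additive_extension :
  exists H : {linear E -> F}, forall x, 0 ≼ x -> H x = h x.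
Proof.
pose k x := h (rpos x) - h (rpos (- x)).
have kB x y : 0 ≼ x -> 0 ≼ y -> k (x - y) = h x - h y.
  move=> x0 y0; apply/eqP; rewrite /k subr_eq addrAC eq_sym subr_eq -!hD ?rpos_ge0//.
  apply/eqP; congr h; apply/eqP.
  by rewrite -subr_eq addrAC eq_sym -subr_eq eq_sym -rposE.
have kZ a x : k (a *: x) = a *: k x.
  have [a0|/ltW a0] := leP 0 a.
    rewrite {1}[x]rposE scalerBr kB ?rscale_ge0 ?rpos_ge0// !hZ ?rpos_ge0//.
    by rewrite -scalerBr.
  have a0' : 0 <= - a by rewrite oppr_ge0.
  rewrite {1}[x]rposE -[a]opprK scaleNr scalerBr opprB.
  rewrite kB ?rscale_ge0 ?rpos_ge0// !hZ ?rpos_ge0//.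
  by rewrite -scalerBr [RHS]scaleNr -scalerN opprB.
have lk : linear k.
  move=> a x y; rewrite -kZ; move: (a *: x) => {}x.
  rewrite {1}[x]rposE {1}[y]rposE addrACA -opprD.
  by rewrite kB ?raddr_ge0 ?rpos_ge0// !hD ?rpos_ge0// opprD addrACA.
pose H : {linear E -> F} := HB.pack k (GRing.isLinear.Build R E F _ k lk).
exists H => x x0; rewrite -[x in LHS]subr0.
have h0 : h 0 = 0 by rewrite -(scale0r (0 : E)) hZ ?rle_refl// scale0r.
by rewrite [LHS]kB ?rle_refl// h0 subr0.
Qed.

End cone_extension.

Section dual_pairing.
Context {R : realType} {E : banachLatticeType R}.
Implicit Types (f g : dual E) (x y : E).

Lemma dual_ge0 f x : 0 ≼ f -> 0 ≼ x -> 0 <= f x.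
Proof. by move=> /dual_leP; apply. Qed.

Lemma dual_le_mono f x y : 0 ≼ f -> x ≼ y -> f x <= f y.
Proof. by move=> f0 xy; rewrite -subr_ge0 -linB dual_ge0// rsub_ge0. Qed.

Lemma rpos_dual f : rpos f = dual_pos f.
Proof. by rewrite -[f in RHS]subr0 -[RHS]add0r. Qed.

(** Disjointness makes [g] the positive part of [g - f], so [g x] is the supremum of [(g - f) y]
    over [y] between 0 and [x]; a nearly optimal [y] works. *)
Lemma rmeet_dual_approx f g x (e : R) : 0 ≼ x -> 0 < e -> rmeet f g = 0 ->
  exists y, [/\ 0 ≼ y, y ≼ x & f y + g (x - y) < e].
Proof.
move=> x0 e0 fg; apply: contrapT => nex.
have : g x <= g x - e.
  have {1}-> : g = dual_pos (g - f) by rewrite -rpos_dual -rsub_meet rmeetC fg subr0.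
  apply: dual_pos_le => // y y0 yx; rewrite leNgt; apply/negP => h.
  apply: nex; exists y; split=> //; rewrite linB.
  rewrite dualDE dualNE in h.
  lra.
by rewrite lerBrDr gerDl leNgt e0.
Qed.

End dual_pairing.

(** * Biadjoints of lattice homomorphisms *)

Section lattice_homomorphism.
Context {R : realType} {E F : banachLatticeType R} (H : {linear E -> F}).
Hypotheses (bH : exists M : R, forall x, `|H x| <= M * `|x|)
  (H0 : forall x, 0 ≼ x -> 0 ≼ H x)
  (Hdp : forall x y, 0 ≼ x -> 0 ≼ y -> rmeet x y = 0 -> rmeet (H x) (H y) = 0).

Lemma lattice_hom_rpos x : rpos (H x) = H (rpos x).
Proof.
rewrite {1}[x]rposE linearB -rsub_meet Hdp ?rpos_ge0 ?rmeet_pos_neg//.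
by rewrite subr0.
Qed.

(* On the range of H, g is dominated by the sublinear functional f \o rpos. *)
Lemma adjoint_interval_preserving (f : dual F) (g : dual E) :
  0 ≼ f -> 0 ≼ g -> g ≼ adjoint bH f ->
  exists f1, [/\ 0 ≼ f1, f1 ≼ f & adjoint bH f1 = g].
Proof.
move=> f0 g0 gf; pose p y : R := f (rpos y).
have sp : sublinear p.
  split=> [x y|].
    by rewrite /p -linD dual_le_mono// rposD_le.
  apply: sublinear_homo_le => [|a x a0].
    by rewrite /p rpos_le0 ?lin0// rle_refl.
  by rewrite /p -linZ dual_le_mono// rposZ_le// ltW.
have [x|f1 [f1p f1H]] := @hahn_banach R E F p H g sp.
  rewrite /p lattice_hom_rpos -(adjointE bH).
  apply: (@le_trans _ _ (g (rpos x))); first by rewrite dual_le_mono// rpos_ge.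
  by move/dual_leP : gf; apply; exact: rpos_ge0.
have bf : exists M : R, forall y, `|f1 y| <= M * `|y|.
  have h y : f1 y <= `|f| * `|y|.
    rewrite (le_trans (f1p y))// (le_trans (ler_norm _))//.
    by rewrite (le_trans (ler_dual_apply f _))// ler_wpM2l// norm_rpos.
  exists `|f| => y; rewrite ler_norml h andbT lerNl -linN.
  by rewrite -[X in _ <= _ * X]normrN h.
have lf : linear (f1 : F -> R^o) by move=> a x y; rewrite linearP.
exists (bounded_dual lf bf); split.
(* The functional [p] agrees with [f] on positive vectors and vanishes on negative ones, whence [f1]
   lies between 0 and [f]. *)
- apply/dual_leP => y y0; rewrite dual0E -oppr_le0 -[X in X <= _](linN f1).
  by rewrite (le_trans (f1p (- y)))// /p rpos_le0 ?lin0// -oppr0 rleNE.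
- apply/dual_leP => y y0; rewrite (le_trans (f1p y))// /p.
  by rewrite dual_le_mono// rpos_le ?rle_refl.
- by apply: dualP => x; exact: f1H.
Qed.

Lemma adjoint_ge0 (f : dual F) : 0 ≼ f -> 0 ≼ adjoint bH f.
Proof. by move=> f0; apply/dual_leP => x x0; exact: (dual_ge0 f0 (H0 x0)). Qed.

Lemma biadjoint_ge0 (u : bidual E) : 0 ≼ u -> 0 ≼ biadjoint bH u.
Proof. by move=> u0; apply/dual_leP => f f0; exact: (dual_ge0 u0 (adjoint_ge0 f0)). Qed.

(** Disjointness of [u] and [v] splits the adjoint of [f] into two positive parts, one small under
    [u] and one small under [v]; interval preservation lifts the splitting to [f] itself. *)
Lemma biadjoint_rmeet (u v : bidual E) : 0 ≼ u -> 0 ≼ v -> rmeet u v = 0 ->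
  rmeet (biadjoint bH u) (biadjoint bH v) = 0.
Proof.
move=> u0 v0 uv; set w := rmeet _ _.
have w0 : 0 ≼ w by rewrite rmeet_ge0// biadjoint_ge0.
apply: rle_antisym => //; apply/dual_leP => f f0; rewrite dual0E.
apply/ler_addgt0Pr => e e0; rewrite add0r.
have [g [g0 gf lt_e]] := rmeet_dual_approx (adjoint_ge0 f0) e0 uv.
have [f1 [f10 f1f f1g]] := adjoint_interval_preserving f0 g0 gf.
rewrite (le_trans _ (ltW lt_e))// -[f in w f](subrK f1) linD addrC -f1g.
apply: lerD; first by have /dual_leP := rmeet_lel (biadjoint bH u) (biadjoint bH v); apply.
have -> : adjoint bH f - adjoint bH f1 = adjoint bH (f - f1) by apply: dualP.
have /dual_leP := rmeet_ler (biadjoint bH u) (biadjoint bH v); apply.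
by rewrite rsub_ge0.
Qed.

End lattice_homomorphism.

Section biadjoint_disjointness.
Context {R : realType} {E F : banachLatticeType R} (T G : {linear E -> F}).
Hypotheses (bT : exists M : R, forall x, `|T x| <= M * `|x|)
  (bG : exists M : R, forall x, `|G x| <= M * `|x|)
  (TG : forall x, 0 ≼ x -> rabs (T x) ≼ G x)
  (Tdp : forall x y, disjoint_vectors x y -> disjoint_vectors (T x) (T y)).

Theorem biadjoint_disjoint (u v : bidual E) : disjoint_vectors u v ->
  disjoint_vectors (biadjoint bT u) (biadjoint bT v).
Proof.
move=> uv.
have [H HE] : exists H : {linear E -> F}, forall x, 0 ≼ x -> H x = rabs (T x).
  apply: (@cone_additive_extension _ _ _ (fun x => rabs (T x))).
    by move=> x y x0 y0; exact: (dp_rabsD TG Tdp).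
  by move=> a x a0 x0; rewrite linearZ rabsZ.
have H0 x : 0 ≼ x -> 0 ≼ H x by move=> x0; rewrite HE// rabs_ge0.
have HG x : 0 ≼ x -> rabs (H x) ≼ G x.
  by move=> x0; rewrite rabs_id ?H0// HE// TG.
have bH : exists M : R, forall x, `|H x| <= M * `|x|.
  have [M GM] := bG; exists M => x.
  rewrite -[X in _ * X]norm_rabs (le_trans _ (GM _))// -norm_rabs.
  by rewrite ler_norm_ge0 ?rabs_ge0// (dominated_rabs HG)// rle_refl.
have Hdp x y : 0 ≼ x -> 0 ≼ y -> rmeet x y = 0 -> rmeet (H x) (H y) = 0.
  by move=> x0 y0 xy; rewrite !HE// (dp_rmeet Tdp).
(* For positive [f] and [x], both [f (T x)] and its opposite are at most [f (H x)]; hence the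
   adjoint of [H] dominates the modulus of the adjoint of [T] at [f]. *)
have le_bi (w : bidual E) : rabs (biadjoint bT w) ≼ biadjoint bH (rabs w).
  have key f : 0 ≼ f -> `|w (adjoint bT f)| <= rabs w (adjoint bH f).
    move=> f0; apply: (le_trans (ler_dual_rabs w (adjoint bT f))).
    apply: (dual_le_mono (rabs_ge0 w)).
    rewrite rabs_le; apply/andP; split; apply/dual_leP => x x0.
      by apply: (dual_le_mono f0); rewrite HE//; exact: rle_joinl.
    rewrite dualNE -[X in X <= _](linN f).
    by apply: (dual_le_mono f0); rewrite HE//; exact: rle_joinr.
  rewrite rabs_le; apply/andP; split; apply/dual_leP => f f0.
    exact: le_trans (ler_norm _) (key f f0).
  by rewrite dualNE (le_trans (ler_norm _))// normrN key.
apply: (@rmeet0_le _ _ _ _ (biadjoint bH (rabs u)) (biadjoint bH (rabs v)));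
  rewrite ?rabs_ge0//.
by apply: biadjoint_rmeet => //; exact: rabs_ge0.
Qed.

End biadjoint_disjointness.

(** * Goldstine's theorem for sequences *)

Section goldstine.
Context {R : realType} {E : normedModType R}.

(* The functional q below measures how well w is approximated by the values of
   the f i; a support functional of q at the target is a combination of the
   coordinates, hence is bounded there by the norm of y. *)
Lemma helly (y : bidual E) (n : nat) (f : 'I_n -> dual E) (e : R) : 0 < e ->
  exists x : E, `|x| <= `|y| + 1 /\ forall i, `|f i x - y (f i)| <= e.
Proof.
move=> e0.
have y1 : 0 < `|y| + 1 by rewrite ltr_wpDl.
(* With this weight, a total cost below the norm of [y] plus 1 forces every coordinate error to be
   at most [e]. *)
pose K := (`|y| + 1) / e.
have K0 : 0 < K by rewrite divr_gt0.
pose N (w : 'rV[R]_n) (x : E) : R := `|x| + K * \sum_i `|w 0 i - f i x|.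
have N_ge0 w x : 0 <= N w x by rewrite addr_ge0// mulr_ge0 ?(ltW K0)// sumr_ge0.
pose q w := inf [set N w x | x in setT].
have hi w : has_inf [set N w x | x in setT].
  by split; [exists (N w 0), 0|exists 0 => _ [x _ <-]].
have q_le w x : q w <= N w x.
  by apply: inf_lbound; [case: (hi w)|exists x].
have q_ge w M : (forall x, M <= N w x) -> M <= q w.
  move=> hM; apply: lb_le_inf; first by case: (hi w).
  by move=> _ [x _ <-].
have sq : sublinear q.
  split=> [w w'|].
    rewrite -lerBlDr; apply: (q_ge) => x.
    rewrite lerBlDr -lerBlDl; apply: (q_ge) => x'.
    rewrite lerBlDl (le_trans (q_le _ (x + x')))// /N addrACA lerD ?ler_normD//.
    rewrite -mulrDr ler_wpM2l ?(ltW K0)// -big_split ler_sum//= => i _.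
    by rewrite mxE linD opprD addrACA ler_normD.
  apply: sublinear_homo_le => [|a w a0].
    apply/eqP; rewrite eq_le q_ge// andbT (le_trans (q_le _ 0))// /N normr0 add0r.
    by rewrite big1 ?mulr0// => i _; rewrite mxE lin0 subrr normr0.
  rewrite -ler_pdivrMl//; apply: (q_ge) => x.
  rewrite ler_pdivrMl// (le_trans (q_le _ (a *: x)))// /N mulrDr.
  rewrite normrZ gtr0_norm// lerD2l mulrCA ler_wpM2l ?(ltW K0)// mulr_sumr.
  by rewrite ler_sum// => i _; rewrite mxE linZ -mulrBr normrM gtr0_norm.
pose z : 'rV[R]_n := \row_i y (f i).
have [c [cq cz]] := sublinear_support z sq.
pose g : dual E := \sum_i (c (delta_mx 0 i) : R) *: f i.
have cE (w : 'rV[R]_n) : c w = \sum_i w 0 i * c (delta_mx 0 i).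
  by rewrite {1}[w]row_sum_delta linear_sum; apply: eq_bigr => i _; exact: linZ.
have gE x : g x = c (\row_i f i x).
  rewrite cE /g.
  have -> : (\sum_i (c (delta_mx 0 i) : R) *: f i : dual E) x =
      \sum_i (c (delta_mx 0 i) : R) * f i x.
    by elim/big_rec2 : _ => [//|i r h _ <-]; rewrite dualDE dualZE.
  by apply: eq_bigr => i _; rewrite mxE mulrC.
(* The image of [v] in coordinates is approximated by [v] without error, so [q] there is at most the
   norm of [v]. *)
have g1 : `|g| <= 1.
  apply: ler_dual_norm => // x; rewrite mul1r.
  have h v : g v <= `|v|.
    rewrite gE (le_trans (cq _))// (le_trans (q_le _ v))// /N.
    by rewrite big1 ?mulr0 ?addr0// => i _; rewrite mxE subrr normr0.
  by rewrite ler_norml h andbT lerNl -linN -[leRHS]normrN h.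
have qz : q z < `|y| + 1.
  rewrite -cz (_ : c z = y g).
    rewrite (@le_lt_trans _ _ `|y|)// ?ltrDl// (le_trans (ler_norm _))//.
    by rewrite (le_trans (ler_dual_apply _ _))// -[leRHS]mulr1 ler_wpM2l.
  rewrite cE linear_sum; apply: eq_bigr => i _.
  by rewrite mxE mulrC; exact/esym/linZ.
have [_ [x _ <-] Nx] := inf_lt (proj1 (hi z)) qz.
exists x; split.
  by rewrite (le_trans _ (ltW Nx))// lerDl mulr_ge0 ?(ltW K0)// sumr_ge0.
move=> i; have : K * `|f i x - y (f i)| <= `|y| + 1.
  rewrite (le_trans _ (ltW Nx))// (@le_trans _ _ (K * \sum_i `|z 0 i - f i x|))//.
    rewrite ler_wpM2l ?(ltW K0)// (bigD1 i)//= mxE distrC lerDl sumr_ge0//.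
  by rewrite lerDr.
by rewrite -ler_pdivlMl// /K invf_div divfK ?gt_eqF.
Qed.

(** [helly] is applied to the first [n] members of a dense sequence in the dual; the uniform norm
    bound carries convergence from this sequence to all functionals. *)
Lemma goldstine_seq (y : bidual E) : separable (dual E) ->
  exists x_ : nat -> E, (forall n, `|x_ n| <= `|y| + 1) /\
    forall f : dual E, f (x_ n) @[n --> \oo] --> y f.
Proof.
move=> [D cD dD].
have [d dP] : exists d : nat -> dual E, forall f (e : R), 0 < e ->
    exists k, `|f - d k| < e.
  have [j ij] : exists j : dual E -> nat, {in D &, injective j}.
    by move: cD => /countable_injP.
  (* The sequence [d] inverts the injection [j]; it is unconstrained at indices outside the range of
     [j] on [D]. *)
  pose P n (f : dual E) := (exists2 g, D g & j g = n) -> D f /\ j f = n.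
  have /choice[d dP] : forall n, exists f, P n f.
    move=> n; have [[g Dg gn]|ng] := pselect (exists2 g, D g & j g = n).
      by exists g.
    by exists 0.
  exists d => f e e0.
  have [|g [fg Dg]] := dD (ball f e)^° _ (@open_interior _ _).
    by exists f; exact: nbhsx_ballx.
  exists (j g); have [|Dd jd] := dP (j g); first by exists g.
  have -> : d (j g) = g by apply: ij; rewrite ?inE.
  by have := interior_subset fg; rewrite -ball_normE.
have /choice[x_ xP] : forall n, exists x : E, `|x| <= `|y| + 1 /\
    forall i : 'I_n, `|d i x - y (d i)| <= n.+1%:R^-1.
  by move=> n; apply: helly; rewrite invr_gt0.
exists x_; split=> [n|f]; first by case: (xP n).
apply/cvgrPdist_le => e e0.
have B0 : 0 < `|y| + 1 by rewrite ltr_wpDl.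
(* Replacing [f] by [d k] costs one term for [y] and one for [x_ n], together at most [e / 2]; the
   other half covers the error at [d k], controlled once [k < n]. *)
have [|k fk] := dP f (e / 2 / ((`|y| + 1) + (`|y| + 1))).
  by rewrite !divr_gt0// addr_gt0.
near=> n.
have kn : (k < n)%N by near: n; exact: nbhs_infty_gt.
have ne : n.+1%:R^-1 <= e / 2 :> R.
  rewrite invf_ple ?posrE ?divr_gt0// (@le_trans _ _ n%:R) ?ler_nat//.
  by near: n; exact: nbhs_infty_ger.
have [xB /(_ (Ordinal kn)) xd] := xP n.
rewrite /= in xd.
have -> : y f - f (x_ n) = (y (f - d k) - (f - d k) (x_ n)) - (d k (x_ n) - y (d k)).
  rewrite dualDE dualNE linB; lra.
rewrite (le_trans (ler_normB _ _))// [e]splitr lerD ?(le_trans xd)//.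
rewrite (le_trans (ler_normB _ _))//.
have h1 : `|y (f - d k)| <= (`|y| + 1) * `|f - d k|.
  by rewrite (le_trans (ler_dual_apply _ _))// ler_wpM2r// lerDl.
have h2 : `|(f - d k) (x_ n)| <= (`|y| + 1) * `|f - d k|.
  by rewrite (le_trans (ler_dual_apply _ _))// mulrC ler_wpM2r.
rewrite (le_trans (lerD h1 h2))// -mulrDl mulrC -ler_pdivlMr ?(addr_gt0 B0 B0)//.
exact: ltW.
Unshelve. all: by end_near. Qed.

End goldstine.

(** * Arens extensions *)

Section weak_cluster.
Context {R : realType} {V : normedModType R}.

Lemma weak_eval_cvg (u : dual V) (g : weak_topology V) :
  (fun h : weak_topology V => u (h : V) : R^o) @ nbhs g --> (u (g : V) : R^o).
Proof.
pose v (x : weak_topology V) : {ptws dual V -> R^o} := fun f : dual V => f (x : V).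
have vc : v @ nbhs g --> v g by exact: initial_continuous.
exact: (proj1 (@pointwise_cvgP _ _ (v @ nbhs g) (v g) _) vc u).
Qed.

(** Each [u] is weakly continuous, so at a weak cluster point it takes a cluster value of a
    convergent real sequence, which is the limit. One [g] serves all [u], and no subsequence is
    extracted. *)
Lemma weak_cluster_limit (h_ : nat -> V) (K : set (weak_topology V)) :
  compact K -> (forall n, K (h_ n)) ->
  exists g : V, forall (u : dual V) (c : R^o),
    u (h_ n) @[n --> \oo] --> c -> u g = c.
Proof.
move=> cK Kh.
pose w (n : nat) : weak_topology V := h_ n.
have wK : \forall n \near \oo, K (w n) by exact: nearW.
have [g [_ gc]] := cK (w @ \oo) _ wK.
exists g => u c uc; apply/eqP; rewrite -subr_eq0 -normr_eq0 eq_le normr_ge0 andbT.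
apply/ler_addgt0Pl => e e0; rewrite addr0.
have e2 : 0 < e / 2 by rewrite divr_gt0.
have /cvgrPdist_le/(_ _ e2) ug := @weak_eval_cvg u g.
have /cvgrPdist_le/(_ _ e2) un := uc.
have [|z [/= z1 z2]] := gc [set z | `|c - u z| <= e / 2] _ _ ug; first exact: un.
have -> : u g - c = (u g - u z) - (c - u z) by rewrite opprB addrA subrK.
by rewrite (le_trans (ler_normB _ _))// [e]splitr lerD.
Qed.

End weak_cluster.

Section evaluation.
Context {R : realType} {E : normedModType R}.

Let eval_linear (x : E) : linear (fun f : dual E => f x : R^o).
Proof. by []. Qed.

Let eval_bounded (x : E) : exists M : R, forall f : dual E, `|f x| <= M * `|f|.
Proof. by exists `|x| => f; rewrite mulrC ler_dual_apply. Qed.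

Definition eval_bidual (x : E) : bidual E :=
  bounded_dual (eval_linear x) (eval_bounded x).

End evaluation.

Section arens_uniqueness.
Context {R : realType} {E F : banachLatticeType R}.

Theorem arens_unique (A : {bilinear E -> E -> F}) (regA : regular_bilinear A) :
  arens_regular E -> separable (dual E) -> arens_id regA =2 arens_theta regA.
Proof.
move=> regE sepE y1 y2; apply: dualP => f.
pose T : {linear E -> dual E} := HB.pack (comp_left regA f)
  (GRing.isLinear.Build R E (dual E) _ (comp_left regA f) (comp_left_linear regA f)).
have cT : continuous T.
  apply: bounded_linear_continuous; apply/linear_boundedP.
  have [M [M0 TM]] := comp_left_norm regA.
  near=> r => x; rewrite (le_trans (TM f x))// ler_wpM2r//.
  by near: r; exact: nbhs_pinfty_ge (num_real _).
have [K TK [cK _]] := regE T cT.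
have [x_ [xM xy]] := goldstine_seq y1 sepE.
set M := `|y1| + 1 in xM.
have M0 : 0 < M by rewrite ltr_wpDl.
(* Weak compactness concerns the image of the unit ball, hence the scaling by [M^-1]. *)
have KT n : K (T (M^-1 *: x_ n)).
  apply: TK; exists (M^-1 *: x_ n) => //=.
  by rewrite normrZ gtr0_norm ?invr_gt0// ler_pdivrMl// mulr1.
have [g gP] := weak_cluster_limit cK KT.
have gE (u : bidual E) : M * u g = y1 (arens_theta_inner regA u f).
  have := gP u (M^-1 * y1 (arens_theta_inner regA u f)) _.
  move=> ->; first by rewrite mulVKf// gt_eqF.
  have -> : (fun n => u (T (M^-1 *: x_ n))) =
      (fun n => M^-1 * arens_theta_inner regA u f (x_ n)).
    by apply/funext => n; rewrite linearZ linZ.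
  by apply: cvgZr; exact: xy.
rewrite arens_idE arens_thetaE -gE.
(* Testing [gE] on evaluations at points of [E] identifies [M *: g] with the inner functional of the
   other extension. *)
have -> : arens_id_inner regA y1 f = M *: g.
  apply: dualP => x2; rewrite dualZE -[g x2]/(eval_bidual x2 g) gE.
  rewrite arens_id_innerE; congr (y1 _); exact: dualP.
exact: linZ.
Unshelve. all: by end_near. Qed.

End arens_uniqueness.

Section flip.
Context {R : realType} {E1 E2 F : lmodType R} (A : {bilinear E1 -> E2 -> F}).

Definition flip (x2 : E2) (x1 : E1) : F := A x1 x2.

Fact flip_bilinear : bilinear_for *:%R *:%R flip.
Proof. by split=> u a x y; rewrite /flip ?linearPl ?linearPr. Qed.

HB.instance Definition _ := bilinear_isBilinear.Build R E2 E1 F *:%R *:%R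
  flip flip_bilinear.

Definition null_bilinear (x1 : E1) (x2 : E2) : F := 0.

Fact null_is_bilinear : bilinear_for *:%R *:%R null_bilinear.
Proof. by split=> u a x y /=; rewrite scaler0 addr0. Qed.

HB.instance Definition _ := bilinear_isBilinear.Build R E1 E2 F *:%R *:%R
  null_bilinear null_is_bilinear.

End flip.

Section positive_bilinear.
Context {R : realType} {E1 E2 F : banachLatticeType R}.
Implicit Types A P : {bilinear E1 -> E2 -> F}.

Lemma positive_bilinear_rabs P x1 x2 c1 c2 : positive_bilinear P ->
  rabs x1 ≼ c1 -> rabs x2 ≼ c2 -> rabs (P x1 x2) ≼ P c1 c2.
Proof.
move=> P0 xc1 xc2.
have key y2 : 0 ≼ y2 -> rabs (P x1 y2) ≼ P c1 y2.
  move: xc1; rewrite !rabs_le -!linearNl => /andP[xc xcN] y20.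
  by rewrite -!(rsub_ge0 _ (P c1 y2)) -!linearBl !P0// rsub_ge0.
have c10 : 0 ≼ c1 by rewrite (rle_tr (rabs_ge0 x1)).
rewrite [x2]rposE linearBr (rle_tr (rabs_triangle _ _))// rabsN.
rewrite (rle_tr (rleD (key _ (rpos_ge0 _)) (key _ (rpos_ge0 _))))//.
by rewrite -linearDr -rabsE -rsub_ge0 -linearBr P0// rsub_ge0.
Qed.

Lemma regular_partial_bounded A x1 : regular_bilinear A ->
  exists M : R, forall x2, `|A x1 x2| <= M * `|x2|.
Proof.
by move=> /regular_bilinear_bounded[M [_ AM]]; exists (M * `|x1|) => x2.
Qed.

Lemma positive_regular_bilinear P : positive_bilinear P -> regular_bilinear P.
Proof.
move=> P0; exists P, (null_bilinear : {bilinear E1 -> E2 -> F}); split=> //.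
  by move=> *; exact: rle_refl.
by move=> x1 x2; rewrite subr0.
Qed.

(** The sum of [P] and [Q] at [rabs x1] dominates; this provides the operator [G] required in
    Meyer's theorem. *)
Lemma regular_partial_dominated A x1 : regular_bilinear A ->
  exists G : {linear E2 -> F}, (exists M : R, forall x, `|G x| <= M * `|x|) /\
    forall x, 0 ≼ x -> rabs (A x1 x) ≼ G x.
Proof.
move=> [P [Q [P0 Q0 APQ]]].
pose G x := P (rabs x1) x + Q (rabs x1) x.
have lG : linear G by move=> a x y; rewrite /G !linearPr scalerDr addrACA.
exists (HB.pack_for {linear E2 -> F} G (GRing.isLinear.Build R E2 F _ G lG)).
split=> [|x x0] /=.
  have [M PM] := regular_partial_bounded (rabs x1) (positive_regular_bilinear P0).
  have [N QN] := regular_partial_bounded (rabs x1) (positive_regular_bilinear Q0).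
  by exists (M + N) => x; rewrite mulrDl (le_trans (ler_normD _ _))// lerD.
rewrite APQ (rle_tr (rabs_triangle _ _))// rabsN.
by rewrite rleD// positive_bilinear_rabs ?(rabs_id x0) ?rle_refl.
Qed.

Lemma flip_regular A : regular_bilinear A ->
  regular_bilinear (flip A : {bilinear E2 -> E1 -> F}).
Proof.
move=> [P [Q [P0 Q0 APQ]]].
exists (flip P : {bilinear E2 -> E1 -> F}), (flip Q : {bilinear E2 -> E1 -> F}).
split=> [x2 x1 x20 x10|x2 x1 x20 x10|x2 x1]; [exact: P0|exact: Q0|exact: APQ].
Qed.

End positive_bilinear.

Section arens_properties.
Context {R : realType} {E1 E2 F : banachLatticeType R}.

(** Through this exchange, disjointness results in the second variable apply to the first. *)
Lemma arens_id_flip (A : {bilinear E1 -> E2 -> F}) (regA : regular_bilinear A)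
    y1 y2 : arens_id regA y1 y2 = arens_theta (flip_regular regA) y2 y1.
Proof.
apply: dualP => f; rewrite arens_idE arens_thetaE; congr (y2 _).
apply: dualP => x2; rewrite arens_id_innerE arens_theta_innerE; congr (y1 _).
exact: dualP.
Qed.

Lemma arens_theta_eval (A : {bilinear E1 -> E2 -> F}) (regA : regular_bilinear A)
    x1 (T : {linear E2 -> F}) (bT : exists M : R, forall x, `|T x| <= M * `|x|) :
  (forall x2, T x2 = A x1 x2) ->
  forall u, arens_theta regA (eval_bidual x1) u = biadjoint bT u.
Proof.
move=> TA u; apply: dualP => f; rewrite arens_thetaE biadjointE.
rewrite -[LHS]/(u (comp_left regA f x1)); congr (u _); apply: dualP => x2.
by rewrite adjointE TA.
Qed.

Lemma arens_theta_ge0 (P : {bilinear E1 -> E2 -> F}) (regP : regular_bilinear P) :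
  positive_bilinear P ->
  positive_bilinear (arens_theta regP : {bilinear bidual E1 -> bidual E2 -> bidual F}).
Proof.
move=> P0 y1 y2 y10 y20; apply/dual_leP => f f0; apply: (dual_ge0 y10).
apply/dual_leP => x1 x10; apply: (dual_ge0 y20).
apply/dual_leP => x2 x20; apply: (dual_ge0 f0); exact: P0.
Qed.

(** The extension is linear in the operator, hence a difference of the positive extensions of [P]
    and [Q]; their sum at the corner [c1], [c2] bounds it. *)
Lemma arens_theta_order_bounded (A : {bilinear E1 -> E2 -> F})
    (regA : regular_bilinear A) : order_bounded_bilinear
  (arens_theta regA : {bilinear bidual E1 -> bidual E2 -> bidual F}).
Proof.
have [P [Q [P0 Q0 APQ]]] := regA.
have regP := positive_regular_bilinear P0.
have regQ := positive_regular_bilinear Q0.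
have thetaE y1 y2 :
    arens_theta regA y1 y2 = arens_theta regP y1 y2 - arens_theta regQ y1 y2.
  apply: dualP => f; rewrite dualDE dualNE !arens_thetaE -linB; congr (y1 _).
  apply: dualP => x1; rewrite dualDE dualNE !arens_theta_innerE -linB; congr (y2 _).
  by apply: dualP => x2; rewrite dualDE dualNE !comp_leftE -linB APQ.
move=> a1 b1 a2 b2.
have interval (G : banachLatticeType R) (a b y : G) :
    a ≼ y -> y ≼ b -> rabs y ≼ rabs a + rabs b.
  move=> ay yb; rewrite rabs_le; apply/andP; split.
    by rewrite (rle_tr yb)// (rle_tr (rle_joinl b (- b)))// rleDr ?rabs_ge0.
  rewrite (rle_tr (rleN ay))// (rle_tr (rle_joinr a (- a)))//.
  by rewrite rleDl ?rabs_ge0.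
set c1 := rabs a1 + rabs b1; set c2 := rabs a2 + rabs b2.
set w := arens_theta regP c1 c2 + arens_theta regQ c1 c2.
exists (- w), w => y1 y2 ay1 yb1 ay2 yb2.
have : rabs (arens_theta regA y1 y2) ≼ w.
  rewrite thetaE (rle_tr (rabs_triangle _ _))// rabsN rleD//.
    exact: (positive_bilinear_rabs (arens_theta_ge0 regP P0)
      (interval _ _ _ _ ay1 yb1) (interval _ _ _ _ ay2 yb2)).
  exact: (positive_bilinear_rabs (arens_theta_ge0 regQ Q0)
    (interval _ _ _ _ ay1 yb1) (interval _ _ _ _ ay2 yb2)).
rewrite rabs_le => /andP[h1 h2]; split=> //.
by rewrite -rleNE opprK.
Qed.

End arens_properties.

(** * Disjointness under weak* sequential limits *)

Section weak_star_limits.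
Context {R : realType} {F : banachLatticeType R}.
Hypothesis wscF : weak_star_seq_continuous_lattice_ops F.

Lemma rabs_weak_star_cvg (y_ : nat -> bidual F) (y : bidual F) :
  (forall f, y_ n f @[n --> \oo] --> y f) ->
  forall f, rabs (y_ n) f @[n --> \oo] --> rabs y f.
Proof.
move=> yf; apply: (proj1 (@cvg_weak_star R (dual F) (fun n => rabs (y_ n)) (rabs y))).
by apply: wscF; apply: (proj2 (@cvg_weak_star R (dual F) y_ y)).
Qed.

(** Continuity of [rabs] is applied to the two sequences and then to the difference of their
    moduli. *)
Lemma disjoint_weak_star_lim (u_ v_ : nat -> bidual F) (u v : bidual F) :
  (forall n, disjoint_vectors (u_ n) (v_ n)) ->
  (forall f, u_ n f @[n --> \oo] --> u f) ->
  (forall f, v_ n f @[n --> \oo] --> v f) ->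
  disjoint_vectors u v.
Proof.
move=> uv /rabs_weak_star_cvg uu /rabs_weak_star_cvg vv.
apply/disjoint_vectorsE/dualP => f.
have h : forall g, (rabs (u_ n) - rabs (v_ n)) g @[n --> \oo] --> (rabs u - rabs v) g.
  by move=> g; apply: cvgB; [exact: uu|exact: vv].
have := @rabs_weak_star_cvg (fun n => rabs (u_ n) - rabs (v_ n)) _ h f.
have -> : (fun n => rabs (rabs (u_ n) - rabs (v_ n)) f) =
    (fun n => rabs (u_ n) f + rabs (v_ n) f : R^o).
  by apply/funext => n; have /disjoint_vectorsE -> := uv n.
move=> h1.
have h2 : (rabs (u_ n) f + rabs (v_ n) f : R^o) @[n --> \oo] --> (rabs u f + rabs v f : R^o).
  by apply: cvgD; [exact: uu|exact: vv].
exact: (cvg_unique _ h1 h2).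
Qed.

End weak_star_limits.

Section arens_disjointness.
Context {R : realType} {E1 E2 F : banachLatticeType R}.
Hypotheses (sepE1 : separable (dual E1))
  (wscF : weak_star_seq_continuous_lattice_ops F).

Theorem arens_theta_disjoint (A : {bilinear E1 -> E2 -> F})
    (regA : regular_bilinear A) :
  (forall x1 x2 y2, disjoint_vectors x2 y2 ->
    disjoint_vectors (A x1 x2) (A x1 y2)) ->
  forall y1 u v, disjoint_vectors u v ->
    disjoint_vectors (arens_theta regA y1 u) (arens_theta regA y1 v).
Proof.
move=> Adp y1 u v uv.
have [x_ [_ xy]] := goldstine_seq y1 sepE1.
(* At [eval_bidual (x_ n)] the extension evaluates a fixed functional on [E1] at [x_ n], so this is
   weak* convergence to [y1]. *)
have theta_cvg w f :
    arens_theta regA (eval_bidual (x_ n)) w f @[n --> \oo] --> arens_theta regA y1 w f.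
  exact: xy.
apply: (disjoint_weak_star_lim wscF _ (theta_cvg u) (theta_cvg v)) => n.
pose t x := A (x_ n) x.
have lt_ : linear t by move=> a x y; rewrite /t linearPr.
pose T : {linear E2 -> F} :=
  HB.pack_for {linear E2 -> F} t (GRing.isLinear.Build R E2 F _ t lt_).
have bT : exists M : R, forall x, `|T x| <= M * `|x|.
  exact: regular_partial_bounded.
have [G [bG TG]] := regular_partial_dominated (x_ n) regA.
rewrite !(arens_theta_eval regA bT (fun=> erefl)).
exact: (@biadjoint_disjoint _ _ _ T G bT bG TG (Adp (x_ n))).
Qed.

End arens_disjointness.

Theorem corollary5p8 (R : realType) (E F : banachLatticeType R)
    (regE : arens_regular E) (sepE : separable (dual E))
    (wscF : weak_star_seq_continuous_lattice_ops F)
    (A : {bilinear E -> E -> F}) (regA : regular_bilinear A)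
    (dpA : disjointness_preserving A) :
  arens_id regA =2 arens_theta regA /\
  disjointness_preserving
    (arens_theta regA : {bilinear bidual E -> bidual E -> bidual F}).
Proof.
have [_ dp2 dp1] := dpA.
have unique := arens_unique regA regE sepE.
split=> //; split.
- exact: arens_theta_order_bounded.
- exact: arens_theta_disjoint.
(* For the first variable, uniqueness passes to [arens_id], which is the [arens_theta] extension of
   the flipped operator. *)
- move=> y2 u v uv; rewrite /= -!unique !arens_id_flip.
  exact: (arens_theta_disjoint sepE wscF).
Qed.
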